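(* Consider an output $y(\eta,z) = \eta_1 - \psi_1(z)$ that has relative degree $\gamma$ and whose zeroing manifold is $\mathcal{M}_\psi = \{(\eta,z)\in N\times Z : \eta - \psi(z) = 0\}$, where $\psi: Z\to N$ is a differentiable map with first component $\psi_1$. If the zero dynamics $\dot z = \omega(\psi(z),z)$ of $\mathcal{M}_\psi$ are exponentially stable, then any output exponentially stabilizing controller $k\in\mathcal{K}$ renders the full state $\zeta=(\eta,z)$ exponentially stable.
   Context: System: a control-affine system on $\mathbb{R}^n$ with scalar input and continuously differentiable vector fields, written (after a diffeomorphic change of coordinates and feedback linearization of an output of relative degree $\gamma$) in the form $\dot\eta = F\eta + Gu$, $\dot z = \omega(\eta,z)$, with $\eta\in N=\mathbb{R}^\gamma$, $z\in Z\subset\mathbb{R}^{n_z}$, $n_z=n-\gamma$, $\zeta=(\eta,z)\in\mathcal{X}=N\times Z$, $u\in\mathbb{R}$. The $\eta$ equations are the chain of integrators $\dot\eta_i=\eta_{i+1}$ for $1\le i\le\gamma-1$, $\dot\eta_\gamma=u$. The system is abbreviated $\dot\zeta=f(\zeta)+g(\zeta)u$. Standing assumption: $\partial\omega/\partial\eta_i=0$ for all $i=3,\dots,\gamma$. Relative degree: with $L_fh=\frac{\partial h}{\partial\zeta}f$ and $L_gh=\frac{\partial h}{\partial\zeta}g$, an output $y:\mathcal{X}\to\mathbb{R}$ has relative degree $\gamma$ if $L_gL_f^ky\equiv0$ for $0\le k\le\gamma-2$ and $L_gL_f^{\gamma-1}y\neq0$. Error coordinates and zeroing manifold: $e = (y,\dot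 y,\dots,y^{(\gamma-1)})$, i.e. $y$ and its first $\gamma-1$ time derivatives along the system. The zeroing manifold of $y$ is the $n_z$-dimensional surface on which $e\equiv0$. Exponential stability: a signal $x(t)$ is exponentially stable on a domain $D$ if there exist $M,\lambda>0$ such that $x(0)=x_0\in D$ implies $\|x(t)\|\le Me^{-\lambda t}\|x_0\|$. Output stabilizing controllers: let $V$ be a control Lyapunov function of the output coordinates $e$, meaning that for some $k_1,k_2,k_3>0$ one has $k_1\|e\|^2\le V(e)\le k_2\|e\|^2$ and $\inf_u\dot V(\zeta,u)\le -k_3V(e)$. Then $\mathcal{K}=\{k(\zeta) : \dot V(\zeta,k(\zeta))\le -k_3V(e)\}$ is the set of output exponentially stabilizing feedback controllers.
   Formalization: The formal theorem assumes in addition that ψ(0)=0, i.e. the origin lies on M_ψ; without it the claim fails (γ=1, ż=−z, ψ≡1, u=−(η−1)). Exponential stability is read locally, on some open neighbourhood of the origin, in both hypothesis and conclusion. *)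

(* Defs.v *)
From HB Require Import structures.
From mathcomp Require Import all_boot all_order all_algebra.
From mathcomp Require Import all_classical all_reals all_analysis.

Set Implicit Arguments.
Unset Strict Implicit.
Unset Printing Implicit Defensive.

Import Order.TTheory GRing.Theory Num.Theory.
Import numFieldNormedType.Exports.

Local Open Scope classical_set_scope.
Local Open Scope ring_scope.

(* Norms are the library's (max) norms on column vectors and on products. They
   only occur in estimates with existentially quantified or arbitrary positive
   constants, so any other norm on R^n would give the same notions. *)

(* Classical solution on [0, T[, T finite, of x' = F x with values in S. Since
   [exp_stable_on] below quantifies over all T > 0, it also constrains solutions
   defined on [0, +oo[ as well as those that escape in finite time. *)
Definition is_solution (R : realType) (E : normedModType R) (S : set E)
    (F : E -> E) (T : R) (x : R -> E) : Prop :=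
  [/\ x t @[t --> 0^'+] --> x 0,
      forall t : R, 0 <= t < T -> S (x t) &
      forall t : R, 0 < t < T -> is_derive t 1 x (F (x t))].

Definition exp_stable_on (R : realType) (E : normedModType R) (S : set E)
    (F : E -> E) (D : set E) : Prop :=
  exists M lambda : R, [/\ 0 < M, 0 < lambda &
    forall (T : R) (x : R -> E), 0 < T -> is_solution S F T x -> D (x 0) ->
      forall t : R, 0 <= t < T ->
        `|x t| <= M * expR (- lambda * t) * `|x 0|].

(* Stability is local: D is some open neighbourhood of the origin in S. *)
Definition exp_stable (R : realType) (E : normedModType R) (S : set E)
    (F : E -> E) : Prop :=
  exists D : set E, [/\ open D, D 0, D `<=` S & exp_stable_on S F D].

Definition C1_on (R : realType) (E W : normedModType R) (S : set E)
    (f : E -> W) : Prop :=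
  (forall x, S x -> differentiable f x) /\
  (forall v x, S x -> {for x, continuous (fun a => 'd f a v)}).

Definition lie (R : realType) (E : normedModType R) (X : E -> E) (h : E -> R)
    : E -> R :=
  fun x => 'd h x (X x).

Definition iter_lie (R : realType) (E : normedModType R) (f : E -> E)
    (y : E -> R) (k : nat) : E -> R :=
  iter k (lie f) y.

(* The first clause makes the iterated Lie derivatives meaningful, as ['d h x]
   is a total operator. *)
Definition has_relative_degree (R : realType) (E : normedModType R)
    (S : set E) (f g : E -> E) (y : E -> R) (gamma : nat) : Prop :=
  [/\ forall k x, (k < gamma)%N -> S x -> differentiable (iter_lie f y k) x,
      forall k x, (k.+1 < gamma)%N -> S x -> lie g (iter_lie f y k) x = 0 &
      forall x, S x -> lie g (iter_lie f y gamma.-1) x != 0].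

(* e = (y, y', ..., y^(gamma-1)); for an output of relative degree gamma these
   time derivatives do not involve u and are the iterated Lie derivatives. *)
Definition error_coord (R : realType) (E : normedModType R) (f : E -> E)
    (y : E -> R) (gamma : nat) (x : E) : 'cV[R]_gamma :=
  \col_(i < gamma) iter_lie f y i x.

(* From here on gamma = d.+1, which encodes gamma >= 1; the component eta_i of
   the mathematical text has index i - 1 in 'I_d.+1. *)
Definition state (R : realType) (d nz : nat) : normedModType R :=
  ('cV[R]_d.+1 * 'cV[R]_nz)%type.

Definition state_space (R : realType) (d nz : nat) (Z : set 'cV[R]_nz)
    : set (state R d nz) :=
  [set zeta | Z zeta.2].

Definition chainF (R : realType) (d : nat) : 'M[R]_d.+1 :=
  \matrix_(i, j) (j == i.+1 :> nat)%:R.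

Definition chainG (R : realType) (d : nat) : 'cV[R]_d.+1 :=
  delta_mx ord_max 0.

Definition drift (R : realType) (d nz : nat)
    (omega : state R d nz -> 'cV[R]_nz) (zeta : state R d nz) : state R d nz :=
  (chainF R d *m zeta.1, omega zeta).

Definition input_field (R : realType) (d nz : nat) (zeta : state R d nz)
    : state R d nz :=
  (chainG R d, 0).

Definition closed_loop (R : realType) (d nz : nat)
    (omega : state R d nz -> 'cV[R]_nz) (k : state R d nz -> R)
    (zeta : state R d nz) : state R d nz :=
  drift omega zeta + k zeta *: input_field zeta.

Definition omega_eta12_only (R : realType) (d nz : nat) (Z : set 'cV[R]_nz)
    (omega : state R d nz -> 'cV[R]_nz) : Prop :=
  forall (i : 'I_d.+1) zeta, (2 <= i)%N -> state_space Z zeta ->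
    'd omega zeta ((delta_mx i 0, 0) : state R d nz) = 0.

Definition output (R : realType) (d nz : nat)
    (psi : 'cV[R]_nz -> 'cV[R]_d.+1) (zeta : state R d nz) : R :=
  zeta.1 ord0 0 - psi zeta.2 ord0 0.

Definition zeroing_manifold (R : realType) (d nz : nat) (Z : set 'cV[R]_nz)
    (omega : state R d nz -> 'cV[R]_nz) (y : state R d nz -> R)
    : set (state R d nz) :=
  [set zeta | state_space Z zeta /\ error_coord (drift omega) y d.+1 zeta = 0].

Definition manifold_of (R : realType) (d nz : nat) (Z : set 'cV[R]_nz)
    (psi : 'cV[R]_nz -> 'cV[R]_d.+1) : set (state R d nz) :=
  [set zeta | state_space Z zeta /\ zeta.1 - psi zeta.2 = 0].

Definition zero_dynamics (R : realType) (d nz : nat)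
    (omega : state R d nz -> 'cV[R]_nz) (psi : 'cV[R]_nz -> 'cV[R]_d.+1)
    (z : 'cV[R]_nz) : 'cV[R]_nz :=
  omega (psi z, z).

(* Derivative of V(e(zeta)) along zeta' = f(zeta) + g(zeta) u. *)
Definition Vdot (R : realType) (d nz : nat)
    (omega : state R d nz -> 'cV[R]_nz) (y : state R d nz -> R)
    (V : 'cV[R]_d.+1 -> R) (zeta : state R d nz) (u : R) : R :=
  lie (closed_loop omega (fun=> u))
    (V \o error_coord (drift omega) y d.+1) zeta.

(* The infimum is taken in the extended reals: it may be -oo. *)
Definition is_output_CLF (R : realType) (d nz : nat) (Z : set 'cV[R]_nz)
    (omega : state R d nz -> 'cV[R]_nz) (y : state R d nz -> R)
    (V : 'cV[R]_d.+1 -> R) (k1 k2 k3 : R) : Prop :=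
  [/\ [/\ 0 < k1, 0 < k2 & 0 < k3],
      forall e, differentiable V e,
      forall e, k1 * `|e| ^+ 2 <= V e <= k2 * `|e| ^+ 2 &
      forall zeta, state_space Z zeta ->
        (ereal_inf (range (fun u : R => (Vdot omega y V zeta u)%:E))
         <= (- k3 * V (error_coord (drift omega) y d.+1 zeta))%:E)%E].

Definition output_stabilizing (R : realType) (d nz : nat) (Z : set 'cV[R]_nz)
    (omega : state R d nz -> 'cV[R]_nz) (y : state R d nz -> R)
    (V : 'cV[R]_d.+1 -> R) (k3 : R) : set (state R d nz -> R) :=
  [set k | forall zeta, state_space Z zeta ->
     Vdot omega y V zeta (k zeta)
     <= - k3 * V (error_coord (drift omega) y d.+1 zeta)].

(* Main.v *)
Require Import Defs.
From mathcomp Require Import all_boot all_order all_algebra.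
From mathcomp Require Import all_classical all_reals all_analysis.
From mathcomp Require Import ring lra.
Import Order.TTheory GRing.Theory Num.Theory.
Import numFieldNormedType.Exports.
Local Open Scope classical_set_scope.
Local Open Scope ring_scope.

Set Implicit Arguments.
Unset Strict Implicit.
Unset Printing Implicit Defensive.

(* Write h_k for the k-th Lie derivative of the output. As omega depends only on
   eta_1, eta_2 and z, h_k depends only on eta_1, .., eta_(k+1) and z, and for
   k >= 1 its slope in eta_(k+1) does not depend on k; by the relative degree
   this slope is nonzero, so the Jacobian of the error e in eta is invertible.
   Since e vanishes on eta = psi(z), near the origin
     |eta - psi'(0) z| <= C (|e| + o(|zeta|))  and
     |omega(zeta) - A z| <= C |e| + o(|z|),
   where A is the derivative at 0 of the zero dynamics.
   Along closed-loop solutions e decays exponentially, V o e being a Lyapunov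
   function. On a time window of fixed length tau, z is compared by Gronwall
   with a solution w of the zero dynamics started at the same point: for tau large, w
   shrinks by a factor 4, so |z| + kappa |e| is halved on each window. As psi is
   only differentiable, the zero dynamics is merely continuous, and w is
   provided by Peano's theorem. *)

(** * Peano's existence theorem *)

Lemma near_dist_lt {R : realType} {E : normedModType R} (x : E) (e : R) :
  0 < e -> \forall y \near x, `|x - y| < e.
Proof. by move=> e0; apply/nbhs_ballP; exists e => //= y; rewrite -ball_normE. Qed.

Lemma continuous_atP {R : realType} {E W : normedModType R} (f : E -> W) x :
  {for x, continuous f} <-> forall e : R, 0 < e ->
    exists2 dl : R, 0 < dl & forall y, `|x - y| < dl -> `|f x - f y| <= e.
Proof.
split=> [fx e e0|fx].
  have /nbhs_ballP[dl /= dl0 H] : \forall y \near x, `|f x - f y| <= e.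
    by move/cvgrPdist_le : fx; exact.
  by exists dl => // y xy; apply: H; rewrite -ball_normE.
apply/cvgrPdist_le => e e0; have [dl dl0 H] := fx _ e0.
by apply: filterS (near_dist_lt x dl0) => y; exact: H.
Qed.

Section cV_norm.
Context {R : realType} {n : nat}.
Implicit Type v : 'cV[R]_n.

Lemma cV_norm_ge v i : `|v i 0| <= `|v|.
Proof.
rewrite [leRHS]/Num.Def.normr/= mx_normrE.
exact: (@le_bigmax _ _ _ 0 (fun ij => `|v ij.1 ij.2|) (i, 0)).
Qed.

Lemma cV_norm_le v c : 0 <= c -> (forall i, `|v i 0| <= c) -> `|v| <= c.
Proof.
move=> c0 vc; rewrite [leLHS]/Num.Def.normr/= mx_normrE.
by apply: bigmax_le => // -[i j] _ /=; rewrite (ord1 j).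
Qed.

(** Heine-Borel: in the max norm the ball is a box, carried over from row vectors by
    transposition. *)
Lemma cV_closed_ball_compact (r : R) : compact [set v : 'cV[R]_n | `|v| <= r].
Proof.
have [r0|r0] := ltP r 0.
  rewrite (_ : mkset _ = set0); first exact: compact0.
  apply/seteqP; split=> // v /= vr.
  by have := le_lt_trans vr r0; rewrite normr_lt0.
have -> : [set v : 'cV[R]_n | `|v| <= r] =
    trmx @` [set u : 'rV[R]_n | forall i, u ord0 i \in `[- r, r]].
  apply/seteqP; split=> [v /= vr|_ [u ur <-]] /=.
    exists v^T; last by rewrite trmxK.
    by move=> i; rewrite mxE in_itv/= -ler_norml (le_trans (cV_norm_ge _ _)).
  apply: cV_norm_le => // i; rewrite mxE.
  by have := ur i; rewrite in_itv/= -ler_norml.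
apply: continuous_compact; last first.
  apply: (@rV_compact R n (fun=> `[- r, r]%classic)) => i.
  exact: segment_compact.
apply: continuous_subspaceT => u; apply/continuous_atP => e e0.
exists e => // w /ltW uw; apply: cV_norm_le => [|i]; first exact: ltW.
rewrite !mxE; apply: le_trans uw; rewrite [leRHS]/Num.Def.normr/= mx_normrE.
have := @le_bigmax _ R _ 0 (fun ij : 'I_1 * 'I_n => `|(u - w) ij.1 ij.2|) (0, i).
by rewrite /= !mxE.
Qed.

(** Bolzano-Weierstrass along an ultrafilter: compactness gives a cluster point, and an ultrafilter
    converges to each of its cluster points. *)
Lemma bounded_ultra_cvg (F : set_system nat) (u : nat -> 'cV[R]_n) (r : R) :
  UltraFilter F -> (forall k, `|u k| <= r) ->
  exists2 l : 'cV[R]_n, `|l| <= r & u k @[k --> F] --> l.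
Proof.
move=> FU ur.
have [|l [lr ul]] := @cV_closed_ball_compact r (u @ F) _.
  by rewrite /fmap/=; apply: filterE => k; exact: ur.
exists l => // B Bl; have [//|FB] := in_ultra_setVsetC (u @^-1` B) FU.
by have [v []] := ul (~` B) B FB Bl.
Qed.

End cV_norm.

Section peano.
Context {R : realType} {n : nat}.
Variables (f : 'cV[R]_n -> 'cV[R]_n) (C : R) (v : 'cV[R]_n).
Hypothesis fC : forall x, `|f x| <= C.
Hypothesis f_ucont : forall e : R, 0 < e -> exists2 dl : R, 0 < dl &
  forall x y, `|x - y| < dl -> `|f x - f y| <= e.

Let euler (h : R) (m : nat) : 'cV[R]_n := iter m (fun x => x + h *: f x) v.

Let C0 : 0 <= C. Proof. exact: le_trans (fC v). Qed.

Let euler_lipschitz (h : R) i m : 0 <= h ->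
  `|euler h (m + i) - euler h i| <= C * (m%:R * h).
Proof.
move=> h0; elim: m => [|m IH]; first by rewrite add0n subrr normr0 mul0r mulr0.
rewrite addSn [euler h _.+1]/= -/(euler h _) addrAC.
rewrite (le_trans (ler_normD _ _))// (_ : _ * _ = C * (m%:R * h) + h * C).
  by rewrite lerD// normrZ ger0_norm// ler_wpM2l.
by rewrite -natr1; ring.
Qed.

(** Each of the m Euler increments uses a slope within e of the initial slope [f (euler h i)],
    because m steps move the iterate by at most [C * (m%:R * h) < dl]. *)
Let euler_dist (h : R) i m e dl : 0 <= h -> C * (m%:R * h) < dl ->
  (forall x y, `|x - y| < dl -> `|f x - f y| <= e) ->
  `|euler h (m + i) - euler h i - (m%:R * h) *: f (euler h i)| <= m%:R * h * e.
Proof.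
(* The induction runs over p <= m with m fixed, so that the bound on the total displacement stays
   available. *)
move=> h0 mdl fe; have: (m <= m)%N by [].
elim: {-2}m => [|p IH] pm.
  by rewrite add0n subrr !mul0r scale0r subr0 normr0.
have -> : euler h (p.+1 + i) - euler h i - (p.+1%:R * h) *: f (euler h i) =
    (euler h (p + i) - euler h i - (p%:R * h) *: f (euler h i)) +
    h *: (f (euler h (p + i)) - f (euler h i)).
  rewrite addSn [euler h _.+1]/= -/(euler h _) -natr1 mulrDl mul1r scalerDl.
  rewrite scalerBr; set a := euler h _; set b := euler _ _.
  by rewrite opprD !addrA; congr (_ - _); rewrite -!addrA; congr (_ + _);
    rewrite addrC -!addrA.
rewrite (le_trans (ler_normD _ _))// -natr1 mulrDl mul1r mulrDl lerD//.
  by apply: IH; exact: ltnW.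
rewrite normrZ ger0_norm// ler_wpM2l// fe// (le_lt_trans _ mdl)//.
rewrite (le_trans (euler_lipschitz _ _ _))// ler_wpM2l// ler_wpM2r// ler_nat.
exact: ltnW.
Qed.

Let h (k : nat) : R := k.+1%:R^-1.
Let u (k : nat) (t : R) := euler (h k) (Num.truncn (t / h k)).

Let h0 k : 0 < h k. Proof. by rewrite invr_gt0 ltr0n. Qed.

(** The number of Euler steps between two times matches their distance up to one step of rounding;
    this is the source of the terms in [h k] below. *)
Let trunc_gap k (s t : R) : 0 <= s -> s <= t ->
  exists2 m, Num.truncn (t / h k) = (m + Num.truncn (s / h k))%N &
   `|m%:R * h k - (t - s)| <= h k.
Proof.
move=> s0 st; set i := Num.truncn (s / h k); set j := Num.truncn (t / h k).
have ij : (i <= j)%N by apply: le_truncn; rewrite ler_pM2r// invr_gt0.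
exists (j - i)%N; first by rewrite subnK.
have t0 := le_trans s0 st.
have /truncn_itv/andP[i1 i2] : 0 <= s / h k by rewrite divr_ge0// ltW.
have /truncn_itv/andP[j1 j2] : 0 <= t / h k by rewrite divr_ge0// ltW.
rewrite -/i -/j -!natr1 in i1 i2 j1 j2.
rewrite ler_pdivlMr// in i1; rewrite ler_pdivlMr// in j1.
rewrite ltr_pdivrMr// in i2; rewrite ltr_pdivrMr// in j2.
rewrite natrB// ler_norml; apply/andP; split; lra.
Qed.

Let u_lipschitz k (s t : R) : 0 <= s -> s <= t ->
  `|u k t - u k s| <= C * (t - s + h k).
Proof.
move=> s0 st; rewrite /u; have [m -> mh] := trunc_gap k s0 st.
rewrite (le_trans (euler_lipschitz _ _ _))//; first exact: ltW.
by rewrite ler_wpM2l//; move: mh; rewrite ler_norml => /andP[_]; lra.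
Qed.

Let u_dist k (s t e dl : R) : 0 <= s -> s <= t -> C * (t - s + h k) < dl ->
  (forall x y, `|x - y| < dl -> `|f x - f y| <= e) -> 0 <= e ->
  `|u k t - u k s - (t - s) *: f (u k s)| <= (t - s) * e + h k * (C + e).
Proof.
move=> s0 st tdl fe e0; rewrite /u; have [m -> mh] := trunc_gap k s0 st.
set i := Num.truncn _.
rewrite (_ : _ - _ = (euler (h k) (m + i) - euler (h k) i -
   (m%:R * h k) *: f (euler (h k) i)) +
   (m%:R * h k - (t - s)) *: f (euler (h k) i)); last first.
  by rewrite [in RHS]scalerBl addrA subrK.
have mh1 : m%:R * h k <= t - s + h k.
  by move: mh; rewrite ler_norml => /andP[_]; lra.
rewrite (le_trans (ler_normD _ _))//.
rewrite (@le_trans _ _ ((m%:R * h k) * e + h k * C))//.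
  apply: lerD.
    apply: euler_dist fe; first exact: ltW.
    by rewrite (le_lt_trans _ tdl)// ler_wpM2l.
  by rewrite normrZ ler_pM.
rewrite mulrDr (addrC (h k * C)) addrA lerD2r -mulrDl ler_wpM2r//.
Qed.

(* Euler's scheme with step 1/(k+1), taken piecewise constant in time, converges
   pointwise along an ultrafilter on k. The estimate
   |u t - u s - (t - s) f(u s)| <= (t - s) eps + O(1/k) for t close to s passes
   to the limit and yields the derivative, without any integral. *)
Lemma peano : exists z : R -> 'cV[R]_n, [/\ z 0 = v,
  forall s t : R, 0 <= s -> s <= t -> `|z t - z s| <= C * (t - s) &
  forall t : R, 0 < t -> is_derive t 1 z (f (z t))].
Proof.
have C1 : 0 < C + 1 by rewrite ltr_wpDl.
have [F [FU ooF]] := ultraFilterLemma (_ : ProperFilter \oo).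
have FF : ProperFilter F by exact: ultra_proper.
have hF : h k @[k --> F] --> 0.
  by apply: (cvg_trans (G := h @ \oo)) cvg_harmonic => A /ooF.
have hlt (e : R) : 0 < e -> \forall k \near F, h k < e.
  move=> e0; have /cvgrPdist_lt /(_ e e0) := hF.
  by apply: filterS => k; rewrite sub0r normrN gtr0_norm.
have u0 k : u k 0 = v by rewrite /u mul0r truncn0.
have ubnd (t : R) : 0 <= t -> forall k, `|u k t| <= `|v| + C * (t + 1).
  move=> t0 k; rewrite -(subrK v (u k t)) addrC (le_trans (ler_normD _ _))//.
  rewrite lerD2l -{1}(u0 k) (le_trans (u_lipschitz _ _ _))// subr0.
  by rewrite ler_wpM2l// lerD2l invf_le1// ler1n.
(* [z t] is a limit for t >= 0; at negative times its value is arbitrary. *)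
have /choice [z zF] (t : R) : exists l : 'cV[R]_n, 0 <= t -> u k t @[k --> F] --> l.
  have [t0|_] := leP 0 t; last by exists 0.
  have [l _ ul] := bounded_ultra_cvg FU (ubnd t t0).
  by exists l.
(* Bounds along the scheme pass to the limit, as the rounding term [h k * a] vanishes along F. *)
have lim_le (w : nat -> 'cV[R]_n) (l : 'cV[R]_n) (c a : R) :
    w @ F --> l -> 0 <= a ->
    (\forall k \near F, `|w k| <= c + h k * a) -> `|l| <= c.
  move=> wl a0 wc; apply/ler_addgt0Pr => e e0.
  have ea0 : 0 < e / (a + 1) by rewrite divr_gt0// ltr_wpDl.
  have wl' : `|w k| @[k --> F] --> `|l| by exact: cvg_norm.
  rewrite -(cvg_lim _ wl')//.
  apply: limr_le; first exact: cvgP wl'.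
  near=> k; rewrite (@le_trans _ _ (c + h k * a))//; first by near: k.
  rewrite lerD2l; have : h k < e / (a + 1) by near: k; exact: hlt.
  rewrite ltr_pdivlMr ?ltr_wpDl// => hk; apply: le_trans (ltW hk).
  by rewrite ler_wpM2l ?lerDl// ltW.
have z_lip (s t : R) : 0 <= s -> s <= t -> `|z t - z s| <= C * (t - s).
  move=> s0 st; apply: (lim_le (fun k => u k t - u k s) _ _ C) => //.
    by apply: cvgB; apply: zF => //; exact: le_trans st.
  apply: nearW => k; rewrite (le_trans (u_lipschitz _ _ _))//.
  by rewrite mulrDr (mulrC C (h k)).
have f_cont : continuous f.
  move=> x; apply/continuous_atP => e /f_ucont[dl dl0 fdl].
  by exists dl => // y; exact: fdl.
have z_dist (s t e dl : R) : 0 <= s -> s <= t -> C * (t - s) < dl ->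
    (forall x y, `|x - y| < dl -> `|f x - f y| <= e) -> 0 <= e ->
    `|z t - z s - (t - s) *: f (z s)| <= (t - s) * e.
  move=> s0 st tdl fe e0.
  apply: (lim_le (fun k => u k t - u k s - (t - s) *: f (u k s)) _ _ (C + e)).
  - apply: cvgB; first by apply: cvgB; apply: zF => //; exact: le_trans st.
    by apply: cvgZl_tmp; apply: continuous_cvg; [exact: f_cont|exact: zF].
  - exact: addr_ge0.
  - have dl1 : 0 < (dl - C * (t - s)) / (C + 1).
      by rewrite divr_gt0 ?subr_gt0.
    near=> k; apply: u_dist fe e0 => //.
    have : h k < (dl - C * (t - s)) / (C + 1) by near: k; exact: hlt.
    rewrite ltr_pdivlMr// => hk; rewrite mulrDr.
    by have := h0 k; lra.
exists z; split => //.
  apply: (@cvg_unique _ (@norm_hausdorff _ _) (u^~ 0 @ F)); first exact: zF.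
  rewrite (_ : u^~ 0 = fun=> v); first exact: cvg_cst.
  by apply/funext => k; exact: u0.
move=> t t0.
have zd : h^-1 *: (z (h *: 1 + t) - z t) @[h --> 0^'] --> f (z t).
  apply/cvgrPdist_le => e e0; have e20 : 0 < e / 2 by rewrite divr_gt0.
  have [dl dl0 fdl] := f_ucont e20.
  near=> a.
  have a0 : a != 0 by near: a; exact: nbhs_dnbhs_neq.
  have aC : C * `|a| < dl.
    have : `|a| < dl / (C + 1).
      by near: a; apply: dnbhs0_lt; rewrite divr_gt0.
    rewrite ltr_pdivlMr// => hk.
    by have := normr_ge0 a; nra.
  have at0 : 0 <= a + t.
    have : `|a| < t by near: a; exact: dnbhs0_lt.
    by rewrite ltr_norml => /andP[]; lra.
  rewrite -[_ - _](scalerK a0) scalerBr (scalerA a a^-1) divff// scale1r.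
  rewrite normrZ normfV ler_pdivrMl ?normr_gt0//.
  rewrite [_ *: 1]mulr1 opprB.
  case: (ltgtP a 0) a0 => // a0 _.
    (* The estimate [z_dist] runs forward in time, so for a < 0 it starts at a + t; replacing the
       slope there by [f (z t)] costs the second half of e. *)
    have na : `|a| = - a by rewrite ltr0_norm.
    have tE : t - (a + t) = `|a| by rewrite na; ring.
    have tat : a + t <= t by lra.
    have := z_dist (a + t) t (e / 2) dl at0 tat.
    rewrite tE => /(_ aC fdl (ltW e20)) H.
    rewrite (_ : _ + _ = (z t - z (a + t) - `|a| *: f (z (a + t))) +
        `|a| *: (f (z (a + t)) - f (z t))); last first.
      by rewrite [in RHS]scalerBr [in RHS]addrA subrK na !scaleNr opprK addrC.
    rewrite (le_trans (ler_normD _ _))// normrZ normr_id.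
    rewrite [in leRHS](splitr e) mulrDr lerD// ler_wpM2l// fdl// distrC.
    by rewrite (le_lt_trans _ aC)// -tE z_lip.
  have tE : a + t - t = `|a| by rewrite gtr0_norm// addrK.
  have tat : t <= a + t by lra.
  have := z_dist t (a + t) (e / 2) dl (ltW t0) tat.
  rewrite tE => /(_ aC fdl (ltW e20)); rewrite gtr0_norm// => H.
  rewrite -normrN opprD opprB addrC; apply: le_trans H _.
  by rewrite ler_pM2l//; lra.
have dz : derivable z t 1 by apply/cvg_ex; exists (f (z t)).
by apply: DeriveDef => //; exact: cvg_lim zd.
Unshelve. all: by end_near. Qed.

End peano.

(** * Gronwall estimates and continuation *)

Section gronwall.
Context {R : realType}.

Lemma derive_le0_decr (f df : R -> R) (T t : R) :
  f s @[s --> 0^'+] --> f 0 ->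
  (forall s : R, 0 < s < T -> is_derive s 1 f (df s)) ->
  (forall s : R, 0 < s < T -> df s <= 0) ->
  0 <= t < T -> f t <= f 0.
Proof.
move=> f0 fdf df0 /andP[]; rewrite le_eqVlt => /predU1P[<-//|t0] tT.
apply: (@ler0_derive1_le_cc _ f 0 t) => //.
- move=> s; rewrite in_itv/= => /andP[s0 st].
  by have [] := fdf s; rewrite // s0 (lt_trans st).
- move=> s; rewrite in_itv/= => /andP[s0 st].
  have sT : 0 < s < T by rewrite s0 (lt_trans st).
  by rewrite derive1E; have [_ ->] := fdf s sT; exact: df0.
- have fc (s : R) : 0 < s < T -> {for s, continuous f}.
    move=> /fdf [fs _]; apply: differentiable_continuous.
    exact/derivable1_diffP.
  apply/continuous_within_itvP => //; split => //.
    by move=> s; rewrite in_itv/= => /andP[s0 st]; apply: fc; rewrite s0 (lt_trans st).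
  by apply: cvg_at_left_filter; apply: fc; rewrite t0.
- by rewrite in_itv/= lexx ltW.
- by rewrite in_itv/= lexx ltW.
- exact: ltW.
Qed.

Lemma is_derive_expRM (c t : R) :
  is_derive t 1 (fun s => expR (c * s)) (c * expR (c * t)).
Proof.
rewrite mulrC; apply: (@is_derive1_comp _ expR ( *%R c)) => //.
by apply: is_derive_eq; rewrite /GRing.scale/= mulr1.
Qed.

(** Shifting N by b / a makes the inequality homogeneous, and the integrating factor
    [expR (- a * s)] makes it monotone. Both signs of a occur: growth in [gronwall], decay in
    [error_exp_decay]. *)
Lemma gronwall_scalar (N dN : R -> R) (a b T t : R) : a != 0 ->
  N s @[s --> 0^'+] --> N 0 ->
  (forall s : R, 0 < s < T -> is_derive s 1 N (dN s)) ->
  (forall s : R, 0 < s < T -> dN s <= a * N s + b) ->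
  0 <= t < T -> N t + b / a <= (N 0 + b / a) * expR (a * t).
Proof.
move=> a0 N0 NdN dNle tT.
pose G (s : R) := (N s + b / a) * expR (- a * s).
have E (s : R) : is_derive s 1 (fun s : R => expR (- a * s)) (- a * expR (- a * s)).
  exact: is_derive_expRM.
have Ed (s : R) : {for s, continuous (fun s : R => expR (- a * s))}.
  by apply: differentiable_continuous; apply/derivable1_diffP; case: (E s).
suff : G t <= G 0.
  rewrite /G mulr0 expR0 mulr1 mulNr expRN ler_pdivrMr ?expR_gt0//.
apply: (@derive_le0_decr G (fun s => (dN s + 0) * expR (- a * s) +
   (N s + b / a) * (- a * expR (- a * s))) T) => //.
- apply: cvgM; first by apply: cvgD => //; exact: cvg_cst.
  by apply: cvg_at_right_filter; exact: Ed.
- move=> s /NdN sT; rewrite /G.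
  apply: is_derive_eq.
  by rewrite /GRing.scale/=; ring.
- move=> s /dNle sT.
  rewrite addr0 (_ : _ + _ = (dN s - (a * N s + b)) * expR (- a * s)).
    by rewrite mulr_le0_ge0 ?expR_ge0// subr_le0.
  by field.
Qed.

End gronwall.

Section bootstrap.
Context {R : realType} {E : normedModType R}.

(** Continuation argument. Let S be the supremum of the times up to which the bound rho has held.
    Before S the bound improves to rho', left continuity then keeps |x S| below rho, and right
    continuity would extend the bound past S if S < t. *)
Lemma bootstrap (x : R -> E) (T rho rho' : R) : rho' < rho ->
  x s @[s --> 0^'+] --> x 0 ->
  (forall s : R, 0 < s < T -> {for s, continuous x}) ->
  `|x 0| < rho ->
  (forall t : R, 0 < t < T -> (forall s, 0 <= s < t -> `|x s| < rho) ->
     forall s : R, 0 <= s < t -> `|x s| <= rho') ->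
  forall t : R, 0 <= t < T -> `|x t| < rho.
Proof.
move=> rr x0c xc x0 step t /andP[t0 tT].
pose A := [set s : R | 0 <= s <= t /\ forall r, 0 <= r <= s -> `|x r| < rho].
have A0 : A 0.
  split; first by rewrite lexx.
  by move=> r /le_anti <-.
have supA : has_sup A by split; [exists 0|exists t => s [/andP[]]].
pose S := sup A.
have S0 : 0 <= S by apply: ub_le_sup => //; case: supA.
have St : S <= t by apply: ge_sup; [exists 0|move=> s [/andP[]]].
have below s : 0 <= s < S -> `|x s| < rho.
  move=> /andP[s0 sS].
  have [r [_ Ar] sr] := sup_gt (let: conj a _ := supA in a) sS.
  by apply: Ar; rewrite s0 ltW.
have xS : `|x S| < rho.
  move: S0; rewrite le_eqVlt => /predU1P[<-//|S0].
  have S0T : 0 < S < T by rewrite S0 (le_lt_trans St).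
  have xS := step S S0T below.
  apply: le_lt_trans rr; rewrite leNgt; apply/negP => lt.
  have e0 : 0 < `|x S| - rho' by rewrite subr_gt0.
  have /cvgrPdist_lt/(_ _ e0) := xc S S0T.
  move=> /nbhs_ballP[dl /= dl0 H].
  pose s := Num.max (S / 2) (S - dl / 2).
  have s1 : 0 <= s < S.
    rewrite le_max gt_max; apply/andP; split; last by apply/andP; split; lra.
    by apply/orP; left; lra.
  have /H : ball S dl s.
    rewrite /ball/= ger0_norm; last by lra.
    have : S - dl / 2 <= s by rewrite le_max lexx orbT.
    by lra.
  have := xS s s1; have := ler_dist_dist (x S) (x s).
  by rewrite ler_norml => /andP[_]; lra.
suff -> : t = S by [].
apply/eqP; rewrite eq_le St andbT leNgt; apply/negP => St'.
have [dl dl0 H] : exists2 dl : R, 0 < dl & forall s, S <= s < S + dl -> `|x s| < rho.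
  have : \forall s \near S^'+, `|x s| < rho.
    have e0 : 0 < rho - `|x S| by rewrite subr_gt0.
    have : x s @[s --> S^'+] --> x S.
      move: S0; rewrite le_eqVlt => /predU1P[<-//|S0].
      apply: cvg_at_right_filter; apply: xc.
      by rewrite S0 (le_lt_trans St).
    move=> /cvgrPdist_lt/(_ _ e0); apply: filterS => s.
    by have := ler_dist_dist (x s) (x S); rewrite distrC ler_norml => /andP[_]; lra.
  move=> /nbhs_ballP[dl /= dl0 H]; exists dl => // s /andP[].
  rewrite le_eqVlt => /predU1P[<-//|Ss] sd; apply: H => //.
  by rewrite /ball/= ltr0_norm ?subr_lt0//; lra.
pose s := Num.min t (S + dl / 2).
have sS : S < s by rewrite lt_min St'/=; lra.
have : s <= S.
  apply: ub_le_sup; first by case: supA.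
  split; first by rewrite ge_min lexx (le_trans S0)// ltW.
  move=> r /andP[r0 rs]; have [rS|rS] := ltP r S; first by apply: below; rewrite r0.
  apply: H; rewrite rS/=; apply: le_lt_trans rs _.
  by rewrite gt_min; apply/orP; right; lra.
by rewrite leNgt sS.
Qed.

End bootstrap.

Lemma is_derive_entry {R : realType} (n : nat) (x : R -> 'cV[R]_n) (t : R)
    (dx : 'cV[R]_n) (i : 'I_n) :
  is_derive t 1 x dx -> is_derive t 1 (fun s => x s i 0) (dx i 0).
Proof.
move=> [xt <-]; apply: DeriveDef; first exact: (derivable_mxP _ _ _).1.
by rewrite derive_mx// mxE.
Qed.

Lemma cvg_entry {R : realType} (n : nat) (F : set_system R) (x : R -> 'cV[R]_n)
    (l : 'cV[R]_n) (i : 'I_n) : Filter F ->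
  x s @[s --> F] --> l -> x s i 0 @[s --> F] --> l i 0.
Proof.
move=> FF /cvgrPdist_le xl; apply/cvgrPdist_le => e /xl; apply: filterS => s.
by apply: le_trans; have := cV_norm_ge (l - x s) i; rewrite !mxE.
Qed.

(* The Euclidean norm of [delta] is used because its square is differentiable. *)
Lemma gronwall {R : realType} (n : nat) (a tau : R) : 0 <= a -> 0 <= tau ->
  exists2 K : R, 0 < K & forall (delta ddelta : R -> 'cV[R]_n) (q T t : R),
    0 <= q -> delta 0 = 0 -> delta s @[s --> 0^'+] --> delta 0 ->
    (forall s : R, 0 < s < T -> is_derive s 1 delta (ddelta s)) ->
    (forall s : R, 0 < s < T -> `|ddelta s| <= a * `|delta s| + q) ->
    0 <= t < T -> t <= tau -> `|delta t| <= K * q.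
Proof.
(* Since 2X(aX + q) <= (2a + 1)X^2 + q^2, the squared Euclidean norm N satisfies N' <= c N + n q^2.
   The added 1 keeps c positive even for n = 0. *)
move=> a0 tau0; pose c : R := n%:R * (2 * a + 1) + 1.
have n0 : 0 <= n%:R :> R by [].
have c0 : 0 < c by rewrite /c; nra.
exists (expR (c * tau)); first exact: expR_gt0.
move=> delta ddelta q T t q0 delta0 delta_r ddeltaE ddelta_le tT ttau.
pose N (s : R) := \sum_(i < n) delta s i 0 ^+ 2.
have N_ge s i : delta s i 0 ^+ 2 <= N s.
  by rewrite /N (bigD1 i)//= lerDl sumr_ge0// => j _; exact: sqr_ge0.
have N_ge0 s : 0 <= N s by rewrite sumr_ge0// => i _; exact: sqr_ge0.
have normN s : `|delta s| ^+ 2 <= N s.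
  rewrite -(sqr_sqrtr (N_ge0 s)) ler_pXn2r ?nnegrE ?sqrtr_ge0//.
  apply: cV_norm_le => [|i]; first exact: sqrtr_ge0.
  by rewrite -sqrtr_sqr ler_wsqrtr.
have Nder s : 0 < s < T ->
    is_derive s 1 N (\sum_(i < n) 2 * delta s i 0 * ddelta s i 0).
  move=> sT.
  have Ni i : is_derive s 1 (fun r => delta r i 0 * delta r i 0)
      (2 * delta s i 0 * ddelta s i 0).
    have di := is_derive_entry i (ddeltaE s sT).
    by apply: is_derive_eq; rewrite /GRing.scale/=; ring.
  have := is_derive_sum Ni.
  by rewrite (_ : \sum_(i < n) _ = N)//; apply/funext => r; rewrite fct_sumE.
have := @gronwall_scalar _ N _ c (n%:R * q ^+ 2) T t (lt0r_neq0 c0) _ Nder _ tT.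
have N00 : N 0 = 0.
  by rewrite /N delta0 big1// => i _; rewrite mxE expr0n.
have Nr : N s @[s --> 0^'+] --> N 0.
  rewrite (_ : N = fun s => \sum_(i < n) delta s i 0 ^+ 2)//.
  apply: cvg_big => [|i _]; first exact: add_continuous.
  by apply: cvgM; exact: cvg_entry.
move=> /(_ Nr) H.
have {H} : N t + n%:R * q ^+ 2 / c <= (N 0 + n%:R * q ^+ 2 / c) * expR (c * t).
  apply: H => s sT.
  have ddn i : `|ddelta s i 0| <= a * `|delta s| + q.
    exact: le_trans (cV_norm_ge _ _) (ddelta_le s sT).
  apply: (@le_trans _ _ (\sum_(i < n) (2 * `|delta s| * (a * `|delta s| + q)))).
    apply: ler_sum => i _; rewrite (le_trans (ler_norm _))// !normrM ger0_norm//.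
    by rewrite -!mulrA ler_wpM2l// ler_pM// cV_norm_ge.
  rewrite sumr_const card_ord -mulr_natl.
  have := normN s; have := sqr_ge0 (`|delta s| - q).
  have := N_ge0 s; rewrite /c.
  move: (N s) (`|delta s|) (normr_ge0 (delta s)) => Ns X X0 Ns0 Xq XN.
  have : 2 * X * (a * X + q) <= (2 * a + 1) * Ns + q ^+ 2 by nra.
  move=> /(ler_wpM2l n0); nra.
rewrite N00 add0r => Nt.
apply: cV_norm_le => [|i]; first by rewrite mulr_ge0 ?expR_ge0.
rewrite -(@ler_pXn2r _ 2)// ?nnegrE ?mulr_ge0 ?expR_ge0// real_normK ?num_real//.
apply: le_trans (N_ge t i) _.
have ect : expR (c * t) <= expR (c * tau) by rewrite ler_expR ler_pM2l.
(* The constant [expR (c * tau)] bounds N / q^2; being at least 1, it is at most its own square and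
   so also serves for the norm itself. *)
have e1 : 1 <= expR (c * tau) by rewrite -expR0 ler_expR mulr_ge0// ltW.
have nc : n%:R * q ^+ 2 / c <= q ^+ 2.
  by rewrite ler_pdivrMr// mulrC ler_wpM2l ?sqr_ge0// /c; nra.
have nc0 : 0 <= n%:R * q ^+ 2 / c by rewrite divr_ge0 ?mulr_ge0 ?sqr_ge0// ltW.
apply: (@le_trans _ _ (q ^+ 2 * expR (c * tau))).
  have : n%:R * q ^+ 2 / c * expR (c * t) <= q ^+ 2 * expR (c * tau).
    by rewrite ler_pM// expR_ge0.
  by lra.
rewrite exprMn mulrC ler_wpM2r ?sqr_ge0// expr2 ler_peMl ?expR_ge0//.
Qed.

(** * Solutions of exponentially stable continuous systems *)

Section zero_dynamics.
Context {R : realType} {n : nat}.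

(** Componentwise truncation is a 1-Lipschitz retraction onto the closed ball of the max norm.
    Composing a field with it yields the globally bounded, uniformly continuous field required by
    [peano]. *)
Definition clamp (r : R) (v : 'cV[R]_n) : 'cV[R]_n :=
  \col_i Num.max (- r) (Num.min r (v i 0)).

Lemma clamp_norm r v : 0 <= r -> `|clamp r v| <= r.
Proof.
move=> r0; apply: cV_norm_le => // i; rewrite mxE ler_norml le_max lexx/=.
by rewrite ge_max ge_min lexx/= andbT; lra.
Qed.

Lemma clamp_id r v : `|v| <= r -> clamp r v = v.
Proof.
move=> vr; apply/colP => i; rewrite mxE.
have := le_trans (cV_norm_ge v i) vr; rewrite ler_norml => /andP[v1 v2].
by rewrite min_r// max_r.
Qed.

Lemma clamp_lipschitz r v w : `|clamp r v - clamp r w| <= `|v - w|.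
Proof.
apply: cV_norm_le => // i; rewrite !mxE.
have := cV_norm_ge (v - w) i; rewrite !mxE !ler_norml.
move=> /andP[]; rewrite /Num.max /Num.min.
by do 4![case: ifPn]; rewrite -?leNgt => *; apply/andP; split; lra.
Qed.

(** Heine-Cantor by contradiction: pairs at distance below 1/(k+1) whose values stay more than e
    apart converge to one common point along an ultrafilter, where f is continuous. *)
Lemma continuous_closed_ball_unif (W : normedModType R) (f : 'cV[R]_n -> W)
    (r e : R) :
  (forall x, `|x| <= r -> {for x, continuous f}) -> 0 < e ->
  exists2 dl : R, 0 < dl & forall x y, `|x| <= r -> `|y| <= r ->
    `|x - y| < dl -> `|f x - f y| <= e.
Proof.
move=> fc e0; apply: contrapT => nH.
have /choice[xy H] (k : nat) : exists p : 'cV[R]_n * 'cV[R]_n,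
    [/\ `|p.1| <= r, `|p.1 - p.2| < k.+1%:R^-1 & ~ `|f p.1 - f p.2| <= e].
  apply: contrapT => nE; apply: nH; exists k.+1%:R^-1; first by rewrite invr_gt0.
  move=> x y xr yr xyk; apply: contrapT => nfe.
  by apply: nE; exists (x, y).
have [F [FU ooF]] := ultraFilterLemma (_ : ProperFilter \oo).
have FF : ProperFilter F by exact: ultra_proper.
have x_r k : `|(xy k).1| <= r by case: (H k).
have [l lr xl] := bounded_ultra_cvg FU x_r.
have e20 : 0 < e / 2 by rewrite divr_gt0.
have /continuous_atP/(_ _ e20)[dl dl0 fdl] := fc l lr.
have dl20 : 0 < dl / 2 by rewrite divr_gt0.
have F1 : \forall k \near F, `|l - (xy k).1| < dl / 2.
  exact: (xl _ (near_dist_lt l dl20)).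
have F2 : \forall k \near F, k.+1%:R^-1 < dl / 2.
  by apply: ooF; exact: near_infty_natSinv_lt (PosNum dl20).
have [k [k1 k2]] := filter_ex (filterI F1 F2).
have [_ k3 k4] := H k; apply: k4.
have d1 : `|l - (xy k).1| < dl.
  by rewrite (lt_trans k1)// ltr_pdivrMr// ltr_pMr// ltr1n.
have d2 : `|l - (xy k).2| < dl.
  apply: le_lt_trans (ler_distD (xy k).1 _ _) _; rewrite (splitr dl) ltrD//.
  exact: lt_trans k3 k2.
apply: le_trans (ler_distD (f l) _ _) _; rewrite (distrC _ (f l)).
by have := fdl _ d1; have := fdl _ d2; lra.
Qed.

(** Exponential stability bounds solutions without providing any. Peano's theorem for the truncated
    field gives a global curve w; while w stays in the ball of radius rho it solves the original
    equation and obeys the stability bound, and [bootstrap] shows that it never leaves. *)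
Lemma exp_stable_flow (Z D : set 'cV[R]_n) (f : 'cV[R]_n -> 'cV[R]_n) :
  open D -> D 0 -> D `<=` Z -> (forall x, D x -> {for x, continuous f}) ->
  exp_stable_on Z f D ->
  exists M lam rho : R, [/\ 1 <= M, 0 < lam, 0 < rho &
    forall v : 'cV[R]_n, M * `|v| < rho -> exists w : R -> 'cV[R]_n,
    [/\ w 0 = v, w s @[s --> 0^'+] --> w 0,
      forall t : R, 0 < t -> is_derive t 1 w (f (w t)) &
      forall t : R, 0 <= t -> `|w t| <= M * expR (- lam * t) * `|v|]].
Proof.
move=> oD D0 DZ fc [M0 [lam [M00 lam0 stab]]].
have /continuous_atP/(_ _ ltr01)[r1 r10 fr1] := fc 0 D0.
have [r2 /= r20 Dr2] : nbhs_ball (0 : 'cV[R]_n) D.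
  by apply/nbhs_ballP; exact: open_nbhs_nbhs.
(* Halving puts the closed ball of radius rho inside both open balls: f is bounded on the first, and
   the second lies in D. *)
pose rho : R := Num.min r1 r2 / 2.
have m0 : 0 < Num.min r1 r2 by rewrite lt_min r10.
have rho0 : 0 < rho by rewrite divr_gt0.
have rr1 : rho < r1.
  have : Num.min r1 r2 <= r1 by rewrite ge_min lexx.
  by rewrite /rho; lra.
have rr2 : rho < r2.
  have : Num.min r1 r2 <= r2 by rewrite ge_min lexx orbT.
  by rewrite /rho; lra.
have Dr x : `|x| <= rho -> D x.
  by move=> xr; apply: Dr2; rewrite -ball_normE/= sub0r normrN; lra.
pose g x := f (clamp rho x).
have gC x : `|g x| <= `|f 0| + 1.
  have : `|f 0 - g x| <= 1.
    apply: fr1; rewrite sub0r normrN (le_lt_trans _ rr1)//.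
    exact/clamp_norm/ltW.
  by have := ler_dist_dist (f 0) (g x); rewrite ler_norml => /andP[]; lra.
have g_ucont e : 0 < e -> exists2 dl : R, 0 < dl &
    forall x y, `|x - y| < dl -> `|g x - g y| <= e.
  move=> e0.
  have [x xr|dl dl0 H] := @continuous_closed_ball_unif _ f rho e _ e0.
    exact/fc/Dr.
  exists dl => // x y xy; apply: H; rewrite ?clamp_norm// ?ltW//.
  exact: le_lt_trans (clamp_lipschitz _ _ _) xy.
(* With M >= 1, the condition [M * |v| < rho] also places v itself in the ball. *)
pose M : R := Num.max 1 M0.
have M1 : 1 <= M by rewrite le_max lexx.
have MM : M0 <= M by rewrite le_max lexx orbT.
exists M, lam, rho; split => // v vrho.
have [w [w0 wlip wder]] := peano v gC g_ucont.
have wr0 : w s @[s --> 0^'+] --> w 0.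
  apply/cvgrPdist_le => e e0.
  have C0 : 0 < `|f 0| + 1 by rewrite ltr_wpDl.
  near=> s; have s0 : 0 < s by near: s; exact: nbhs_right_gt.
  rewrite distrC (le_trans (wlip _ _ (lexx 0) (ltW s0)))// subr0.
  rewrite mulrC -ler_pdivlMr//; apply: ltW.
  by near: s; apply: nbhs_right_lt; rewrite divr_gt0.
have vlt : `|v| < rho.
  by apply: le_lt_trans vrho; rewrite ler_peMl.
have sol (t : R) : 0 < t -> (forall s, 0 <= s < t -> `|w s| < rho) ->
    forall s : R, 0 <= s < t -> `|w s| <= M * expR (- lam * s) * `|v|.
  move=> t0 wt s st.
  have := stab t w t0; rewrite w0 => /(_ _ _ s st) H.
  apply: le_trans (H _ _) _.
  - split; first exact: wr0.
    + by move=> r rt; apply: (DZ); apply/Dr/ltW/wt.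
    + move=> r /andP[r0 rt]; have := wder r r0.
      by rewrite /g clamp_id// ltW// wt// rt ltW.
  - by apply: Dr; exact: ltW.
  - by rewrite ler_wpM2r// ler_wpM2r// expR_ge0.
have wlt (T t : R) : 0 <= t < T -> `|w t| < rho.
  apply: (@bootstrap _ _ w T rho (M * `|v|)) => //.
  - move=> s /andP[s0 _]; have [ws _] := wder s s0.
    exact/differentiable_continuous/derivable1_diffP.
  - by rewrite w0.
  - move=> r /andP[r0 _] wr s sr; apply: le_trans (sol r r0 wr s sr) _.
    have /andP[s0 _] := sr.
    rewrite ler_wpM2r// ler_piMr ?(le_trans ler01)// -[leRHS]expR0 ler_expR.
    by rewrite mulNr oppr_le0 mulr_ge0// ltW.
exists w; split => //.
  move=> t t0; have := wder t t0; rewrite /g clamp_id// ltW//.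
  by apply: (wlt (t + 1)); rewrite ltW//= ltrDl.
move=> t t0; apply: (sol (t + 1)).
- by rewrite ltr_wpDl.
- by move=> s; exact: wlt.
- by rewrite t0/= ltrDl.
Unshelve. all: by end_near. Qed.

(** The bound forces the solution from 0 to vanish identically, so its derivative [f 0] at time 1 is
    0. For the zero dynamics this yields [omega 0 = 0]. *)
Lemma exp_stable_flow_equilibrium (f : 'cV[R]_n -> 'cV[R]_n) (M lam rho : R) :
  0 < rho ->
  (forall v : 'cV[R]_n, M * `|v| < rho -> exists w : R -> 'cV[R]_n,
    [/\ w 0 = v, w s @[s --> 0^'+] --> w 0,
      forall t : R, 0 < t -> is_derive t 1 w (f (w t)) &
      forall t : R, 0 <= t -> `|w t| <= M * expR (- lam * t) * `|v|]) ->
  f 0 = 0.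
Proof.
move=> rho0 /(_ 0); rewrite normr0 mulr0 => /(_ rho0)[w [_ _ wder wle]].
have w0 t : 0 <= t -> w t = 0.
  by move=> /wle; rewrite mulr0 normr_le0 => /eqP.
have := wder 1 ltr01; rewrite w0// => w1.
have [_ <-] := w1; rewrite -[RHS](derive_cst (0 : 'cV[R]_n) (1 : R) (1 : R)).
apply: near_eq_derive; apply: filterS (near_dist_lt (1 : R) ltr01) => t.
by rewrite ltr_norml => /andP[_ t1]; apply: w0; lra.
Qed.

End zero_dynamics.

(** * Error coordinates *)

Lemma is_derive_line {R : realType} {E : normedModType R} (x v : E) (c : R) :
  is_derive c 1 (fun s : R => x + s *: v) v.
Proof.
have : is_derive c 1 (fun s : R => s *: v) v.
  apply: DeriveDef; first exact/derivable1_diffP.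
  by rewrite deriveE// diff_val scale1r.
by move=> H; apply: is_derive_eq; rewrite add0r.
Qed.

Section differential.
Context {R : realType} {E W : normedModType R}.
Implicit Types (f : E -> W).

Lemma diff_near f (x : E) (e : R) : differentiable f x -> 0 < e ->
  \forall h \near (0 : E), `|f (h + x) - f x - 'd f x h| <= e * `|h|.
Proof.
move=> /diff_locally fx e0; have /eqaddoP/(_ _ e0) := fx.
by apply: filterS => h; rewrite !fctE /= opprD addrA.
Qed.

Lemma is_derive_diff_comp f (x : R -> E) (t : R) (dx : E) :
  is_derive t 1 x dx -> differentiable f (x t) ->
  is_derive t 1 (f \o x) ('d f (x t) dx).
Proof.
move=> [xt <-] ft; have dxt : differentiable x t by exact/derivable1_diffP.
have dfx : differentiable (f \o x) t by exact: differentiable_comp.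
apply: DeriveDef; first exact/derivable1_diffP.
by rewrite !deriveE// diff_comp.
Qed.

Lemma diff_line f (x v : E) (a : W) : differentiable f x ->
  (forall c : R, f (x + c *: v) = f x + c *: a) -> 'd f x v = a.
Proof.
move=> fx fa; have xE : x = x + 0 *: v by rewrite scale0r addr0.
have fx' : differentiable f (x + 0 *: v) by rewrite -xE.
have [_] := is_derive_diff_comp (is_derive_line x v 0) fx'.
rewrite -xE => <-; rewrite (_ : _ \o _ = fun c => f x + c *: a); last first.
  exact/funext.
by have [_ ->] := is_derive_line (f x) a 0.
Qed.

Lemma diff_line0 f (x v : E) : differentiable f x ->
  (forall c : R, f (x + c *: v) = f x) -> 'd f x v = 0.
Proof.
by move=> fx fv; apply: diff_line => // c; rewrite scaler0 addr0.
Qed.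

(** Near x the translate of f by u coincides with f, so the directional derivatives agree. *)
Lemma diff_shift_eq f (S : set E) (x u v : E) : open S -> S x ->
  (forall y, S y -> f (y + u) = f y) ->
  differentiable f x -> differentiable f (x + u) -> 'd f (x + u) v = 'd f x v.
Proof.
move=> oS Sx fu fx fxu; rewrite -!deriveE//.
rewrite -(@near_eq_derive _ _ _ (fun y => f (y + u)) f x v); last first.
  by near=> y; apply: fu; near: y; exact: open_nbhs_nbhs.
by rewrite /derive; under [in RHS]eq_fun do rewrite /= -addrA.
Unshelve. all: by end_near. Qed.

End differential.

(** * Triangular structure of the Lie derivatives of the output *)

Section chain.
Context {R : realType} {d nz : nat}.
Variables (Z : set 'cV[R]_nz) (omega : state R d nz -> 'cV[R]_nz).
Variable psi : 'cV[R]_nz -> 'cV[R]_d.+1.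
Hypothesis oZ : open Z.
Hypothesis omega_diff : forall x, state_space Z x -> differentiable omega x.
Hypothesis omega12 : omega_eta12_only Z omega.
Hypothesis reldeg : has_relative_degree (state_space Z) (drift omega)
  (@input_field R d nz) (output psi) d.+1.

Let S : set (state R d nz) := state_space Z.
Let b (i : 'I_d.+1) : state R d nz := (delta_mx i 0, 0).
Let h k := iter_lie (drift omega) (output psi) k.

Let h_diff k x : (k <= d)%N -> S x -> differentiable (h k) x.
Proof. by case: reldeg => H _ _; exact: H. Qed.

Lemma open_state_space : open (state_space Z : set (state R d nz)).
Proof.
rewrite (_ : state_space Z = snd @^-1` Z)//.
by apply: open_comp => // x _; exact: cvg_snd.
Qed.

Let S_shift x (c : R) i : S x -> S (x + c *: b i).
Proof. by rewrite /S /state_space/= scaler0 addr0. Qed.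

(** Lines in an eta direction stay in S, which constrains only z; a partial derivative vanishing on
    S therefore gives constancy along the whole line. *)
Let omega_shift x (c : R) (i : 'I_d.+1) : S x -> (2 <= i)%N ->
  omega (x + c *: b i) = omega x.
Proof.
move=> Sx i2; apply/colP => j.
pose g s := omega (x + s *: b i) j 0.
suff -> : omega x j 0 = g 0.
  apply: (@is_derive_0_is_cst _ g) => s.
  have dw : differentiable omega (x + s *: b i) by exact/omega_diff/S_shift.
  have := is_derive_diff_comp (is_derive_line x (b i) s) dw.
  have -> : 'd omega (x + s *: b i) (b i) = 0 := omega12 i2 (S_shift s i Sx).
  by move=> /(is_derive_entry j); rewrite mxE.
by rewrite /g scale0r addr0.
Qed.

Let drift_shift x (c : R) (i j : 'I_d.+1) : S x -> (2 <= i)%N -> i = j.+1 :> nat ->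
  drift omega (x + c *: b i) = drift omega x + c *: b j.
Proof.
move=> Sx i2 ij; rewrite /drift omega_shift//; congr pair; last first.
  by rewrite /= scaler0 addr0.
rewrite /= mulmxDr -scalemxAr; congr (_ + _ *: _).
apply/colP => r; rewrite !mxE (bigD1 i)//= big1 ?addr0; last first.
  by move=> s si; rewrite !mxE (negPf si) mulr0.
by rewrite !mxE !eqxx mulr1 ij eqSS andbT eq_sym.
Qed.

Let hS k x : h k.+1 x = 'd (h k) x (drift omega x).
Proof. by []. Qed.

(** If [h k] is invariant along [b i], so is its differential, while the integrator chain moves the
    drift by [c *: b j]. Hence [h k.+1] is affine in c, with the slope of [h k] along [b j]. *)
Let h_shift_aux k x (c : R) (i j : 'I_d.+1) : (k < d)%N -> S x -> (2 <= i)%N ->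
  i = j.+1 :> nat -> (forall y, S y -> h k (y + c *: b i) = h k y) ->
  h k.+1 (x + c *: b i) = h k.+1 x + c * 'd (h k) x (b j).
Proof.
move=> kd Sx i2 ij hk.
have hx : differentiable (h k) x by apply: h_diff => //; exact: ltnW.
have hxc : differentiable (h k) (x + c *: b i).
  by apply: h_diff; [exact: ltnW|exact: S_shift].
have E : 'd (h k) (x + c *: b i) (drift omega x + c *: b j) =
    'd (h k) x (drift omega x + c *: b j).
  exact: diff_shift_eq open_state_space Sx hk hx hxc.
rewrite (hS k x).
rewrite (hS k (x + c *: b i)).
rewrite (drift_shift c Sx i2 ij).
apply: (etrans E).
rewrite linearD.
by rewrite linearZ.
Qed.

(** Induction on k: a shift along an index above k + 1 moves the drift only along the preceding
    index, still above k, to which [h k] is insensitive. *)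
Let h_indep k : (k <= d)%N -> forall x c (i : 'I_d.+1), S x -> (k < i)%N ->
  h k (x + c *: b i) = h k x.
Proof.
elim: k => [_|k IH kd] x c i Sx ki.
  rewrite /h /iter_lie/= /output/= scaler0 addr0 !mxE.
  by rewrite (_ : ord0 == i = false) ?mulr0 ?addr0//; case: i ki => -[].
have i0 : (0 < i)%N by exact: leq_ltn_trans ki.
have jd : (i.-1 < d.+1)%N by rewrite prednK// ltnW.
have ij : i = (Ordinal jd).+1 :> nat by rewrite /= prednK.
have k_lt_j : (k < Ordinal jd)%N by rewrite -ltnS -ij.
rewrite (h_shift_aux kd Sx _ ij); last 2 first.
- exact: leq_ltn_trans ki.
- by move=> y Sy; apply: IH => //; exact: ltnW.
have -> : 'd (h k) x (b (Ordinal jd)) = 0; last by rewrite mulr0 addr0.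
apply: diff_line0; first by apply: h_diff => //; exact: ltnW.
by move=> s; apply: IH => //; exact: ltnW.
Qed.

Let diff_h_lt x (k i : 'I_d.+1) : S x -> (k < i)%N -> 'd (h k) x (b i) = 0.
Proof.
move=> Sx ki; have kd : (k <= d)%N by rewrite -ltnS.
by apply: diff_line0 => [|c]; [exact: h_diff|exact: h_indep].
Qed.

(** The condition 0 < k makes i at least 2, the range in which [omega] is constant along [b i]. *)
Let diff_h_step x (k i : 'I_d.+1) : S x -> (0 < k)%N -> i = k.+1 :> nat ->
  'd (h k.+1) x (b i) = 'd (h k) x (b k).
Proof.
move=> Sx k0 ik.
have kd : (k < d)%N by have := ltn_ord i; rewrite ik ltnS.
have i2 : (2 <= i)%N by rewrite ik ltnS.
apply: diff_line => [|c]; first exact: h_diff.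
apply: h_shift_aux => // y Sy; apply: h_indep => //; first exact: ltnW.
by rewrite ik.
Qed.

(** For k = 0 the slope is 1, read off the output. For k > 0 it is carried upwards by [diff_h_step]
    to the last index. *)
Let diff_h_diag x (k : 'I_d.+1) : S x -> 'd (h k) x (b k) != 0.
Proof.
move=> Sx; have [k0|k0] := posnP k.
  have -> : 'd (h k) x (b k) = 1; last exact: oner_neq0.
  apply: diff_line => [|c]; first by apply: h_diff => //; rewrite -ltnS.
  have -> : h k = output psi by rewrite k0.
  rewrite /output.
  rewrite [(x + c *: b k).2]/= scaler0 addr0 !mxE.
  rewrite (_ : ord0 == k); last by rewrite -val_eqE /= k0.
  by rewrite /GRing.scale/= !mulr1 addrAC.
have [m] : exists m, (k + m)%N = d.
  by exists (d - k)%N; rewrite subnKC// -ltnS.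
elim: m k k0 => [|m IH] k k0 km.
  (* At the last index [b ord_max] is the input field, so the slope is L_g L_f^d y, nonzero by the
     relative degree. *)
  case: reldeg => _ _ /(_ x Sx).
  rewrite addn0 in km; have -> : k = ord_max by exact: val_inj.
  exact.
have kd : (k.+1 < d.+1)%N by have := leq_addr m k.+1; rewrite addSn -addnS km.
have <- := @diff_h_step x k (Ordinal kd) Sx k0 erefl.
by apply: (IH (Ordinal kd)) => //; rewrite /= addSn -addnS.
Qed.

(* The Jacobian of the error coordinates with respect to eta is lower triangular
   with diagonal 1, a, .., a and a != 0, because h_(k+1) is affine in
   eta_(k+2) with slope d h_k / d eta_(k+1). *)
Definition error_jac (x : state R d nz) : 'M[R]_d.+1 :=
  \matrix_(k, i) 'd (iter_lie (drift omega) (output psi) k) x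
    ((delta_mx i 0, 0) : state R d nz).

Lemma error_jac_unit x : state_space Z x -> error_jac x \in unitmx.
Proof.
move=> Sx; rewrite unitmxE det_trig; last first.
  by apply/is_trig_mxP => k i ki; rewrite mxE; exact: diff_h_lt.
rewrite unitfE; apply/prodf_neq0 => k _; rewrite mxE; exact: diff_h_diag.
Qed.

Lemma error_jacE x (v : 'cV[R]_d.+1) :
  error_jac x *m v = \col_k 'd (iter_lie (drift omega) (output psi) k) x
    ((v, 0) : state R d nz).
Proof.
apply/colP => k; rewrite !mxE.
have -> : ((v, 0) : state R d nz) = \sum_i v i 0 *: b i.
  apply: injective_projections; rewrite /= ?(raddf_sum fst) ?(raddf_sum snd)/=.
    by rewrite {1}(matrix_sum_delta v); apply: eq_bigr => i _; rewrite big_ord1.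
  by rewrite big1// => i _; rewrite scaler0.
rewrite linear_sum; apply: eq_bigr => i _; rewrite linearZ !mxE mulrC//.
Qed.

End chain.

Lemma mulmx_norm_le {R : realType} (m n : nat) (A : 'M[R]_(m, n)) :
  exists2 C : R, 0 < C & forall v : 'cV[R]_n, `|A *m v| <= C * `|v|.
Proof.
pose C : R := \sum_i \sum_j `|A i j|.
have C0 : 0 <= C by rewrite sumr_ge0// => i _; rewrite sumr_ge0.
exists (C + 1) => [|v]; first by rewrite ltr_wpDl.
apply: (@le_trans _ _ (C * `|v|)); last by rewrite ler_wpM2r// lerDl.
apply: cV_norm_le => [|i]; first by rewrite mulr_ge0.
rewrite mxE (le_trans (ler_norm_sum _ _ _))//.
apply: (@le_trans _ _ ((\sum_j `|A i j|) * `|v|)).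
  rewrite mulr_suml; apply: ler_sum => j _.
  by rewrite normrM ler_wpM2l// cV_norm_ge.
rewrite ler_wpM2r// /C (bigD1 i)//= lerDl sumr_ge0// => k _; exact: sumr_ge0.
Qed.

Lemma diff_bound {R : realType} {E W : normedModType R} (f : E -> W) (x : E) :
  differentiable f x -> exists2 C : R, 0 < C & forall v, `|'d f x v| <= C * `|v|.
Proof. by move=> fx; apply: linear_lipschitz; exact: diff_continuous. Qed.

(** * First-order estimates at the origin *)

Section estimates.
Context {R : realType} {d nz : nat}.
Variables (Z : set 'cV[R]_nz) (omega : state R d nz -> 'cV[R]_nz).
Variable psi : 'cV[R]_nz -> 'cV[R]_d.+1.
Hypothesis oZ : open Z.
Hypothesis Z0 : Z 0.
Hypothesis omega_diff : forall x, state_space Z x -> differentiable omega x.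
Hypothesis omega12 : omega_eta12_only Z omega.
Hypothesis reldeg : has_relative_degree (state_space Z) (drift omega)
  (@input_field R d nz) (output psi) d.+1.
Hypothesis psi_diff : forall z, Z z -> differentiable psi z.
Hypothesis psi0 : psi 0 = 0.
Hypothesis manifold :
  zeroing_manifold Z omega (output psi) = manifold_of Z psi.
Hypothesis omega0 : omega 0 = 0.

Let S : set (state R d nz) := state_space Z.
Let h (k : nat) : state R d nz -> R := iter_lie (drift omega) (output psi) k.
Let e : state R d nz -> 'cV[R]_d.+1 :=
  error_coord (drift omega) (output psi) d.+1.
Let Dpsi (z : 'cV[R]_nz) : 'cV[R]_d.+1 := 'd psi (0 : 'cV[R]_nz) z.
Let Dh (k : nat) (x : state R d nz) : R := 'd (h k) (0 : state R d nz) x.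

Let S0 : S 0. Proof. exact: Z0. Qed.

Let h_diff (k : 'I_d.+1) x : S x -> differentiable (h k) x.
Proof. by case: reldeg => H _ _; exact: H. Qed.

Lemma error_coord_differentiable x : S x -> differentiable e x.
Proof.
move=> Sx.
have -> : e = \sum_(i < d.+1) (fun y => h i y *: (delta_mx i 0 : 'cV[R]_d.+1)).
  apply/funext => y; rewrite fct_sumE [LHS]matrix_sum_delta.
  by apply: eq_bigr => i _; rewrite big_ord1 mxE.
by apply: differentiable_sum => i; apply: differentiableZl; exact: h_diff.
Qed.

Let e_manifold z : Z z -> e (psi z, z) = 0.
Proof.
move=> Zz.
have : manifold_of Z psi ((psi z, z) : state R d nz) by split => //=; rewrite subrr.
by rewrite -manifold => -[].
Qed.

Let psi0E : ((psi 0, 0) : state R d nz) = 0.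
Proof. by rewrite psi0. Qed.

Let e0 : e 0 = 0. Proof. by have := e_manifold Z0; rewrite psi0E. Qed.

Let e_entry (k : 'I_d.+1) x : e x k 0 = h k x. Proof. by rewrite mxE. Qed.

Let Dh_near (eps : R) : 0 < eps -> \forall x \near (0 : state R d nz),
  `|e x - \col_k Dh k x| <= eps * `|x|.
Proof.
move=> eps0.
have H (k : 'I_d.+1) : \forall x \near (0 : state R d nz),
    `|h k x - Dh k x| <= eps * `|x|.
  apply: filterS (diff_near (h_diff k S0) eps0) => x; rewrite addr0.
  by have <- := e_entry k 0; rewrite e0 mxE subr0.
have H' : \forall x \near (0 : state R d nz), forall k : 'I_d.+1,
    `|h k x - Dh k x| <= eps * `|x|.
  exact: (@filter_forall _ _
    (fun (k : 'I_d.+1) x => `|h k x - Dh k x| <= eps * `|x|) _ _ H).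
near=> x; have Hx (k : 'I_d.+1) : `|h k x - Dh k x| <= eps * `|x|.
  by move: k; near: x.
apply: cV_norm_le => [|k]; first by rewrite mulr_ge0// ltW.
by have := Hx k; rewrite !mxE.
Unshelve. all: by end_near. Qed.

(** The vector [(Dpsi z, z)] is tangent at the origin to the graph of psi, along which [h k]
    vanishes. *)
Let Dh_tangent (k : 'I_d.+1) z : Dh k (Dpsi z, z) = 0.
Proof.
pose g (y : 'cV[R]_nz) : state R d nz := (psi y, y).
have psiD : differentiable psi (0 : 'cV[R]_nz) by exact: psi_diff.
have idD : differentiable id (0 : 'cV[R]_nz) by exact: ex_diff.
have gD : differentiable g (0 : 'cV[R]_nz) by exact: differentiable_pair.
have dg : 'd g (0 : 'cV[R]_nz) z = (Dpsi z, z).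
  have -> : 'd g (0 : 'cV[R]_nz) z =
      ('d psi (0 : 'cV[R]_nz) z, 'd id (0 : 'cV[R]_nz) z).
    by rewrite (diff_pair psiD idD).
  by rewrite diff_val.
have g0 : g 0 = 0 by exact: psi0E.
have hg : differentiable (h k) (g 0) by rewrite g0; exact: h_diff.
have -> : Dh k (Dpsi z, z) = 'd (h k \o g) (0 : 'cV[R]_nz) z.
  by rewrite diff_comp//= g0 dg.
rewrite -deriveE; last exact: differentiable_comp.
rewrite -[RHS](derive_cst (0 : R) (0 : 'cV[R]_nz) z).
apply: near_eq_derive; near=> y.
rewrite /cst/= -e_entry e_manifold ?mxE//.
by near: y; exact: open_nbhs_nbhs.
Unshelve. all: by end_near. Qed.

(** Subtracting the tangent vector [(Dpsi x.2, x.2)], which [Dh] kills, leaves an increment in eta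
    alone. *)
Let Dh_eta x : \col_k Dh k x = error_jac omega psi 0 *m (x.1 - Dpsi x.2).
Proof.
rewrite error_jacE; apply/colP => k; rewrite !mxE.
rewrite -[RHS]addr0 -(Dh_tangent k x.2) /Dh -linearD; congr ('d _ _ _).
by apply: injective_projections; rewrite /= ?subrK ?add0r.
Qed.

Let norm_state (x : state R d nz) : `|x| <= `|x.1| + `|x.2|.
Proof. by rewrite prod_normE ge_max lerDl lerDr !normr_ge0. Qed.

(** The deviation from the tangent space is recovered from e by inverting the Jacobian. C is fixed
    before eps, so the term in eps can be absorbed later. *)
Let eta_near : exists2 C : R, 0 < C & forall eps : R, 0 < eps ->
  \forall x \near (0 : state R d nz),
    `|x.1 - Dpsi x.2| <= C * (`|e x| + eps * `|x|).
Proof.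
have [C C0 HC] := mulmx_norm_le (invmx (error_jac omega psi 0)).
have Ju := error_jac_unit oZ omega_diff omega12 reldeg S0.
exists C => // eps eps0; apply: filterS (Dh_near eps0) => x xe.
have -> : x.1 - Dpsi x.2 = invmx (error_jac omega psi 0) *m (\col_k Dh k x).
  by rewrite Dh_eta mulKmx.
apply: (le_trans (HC _)); rewrite ler_wpM2l ?(ltW C0)//.
rewrite -lerBlDl; apply: le_trans xe.
by rewrite distrC; apply: le_trans (ler_dist_dist _ _); exact: ler_norm.
Qed.

(** The witness A is the derivative at 0 of the zero dynamics, so the true z-equation and the zero
    dynamics are compared with one and the same linear map. K may depend on eps, whereas a and C may
    not. *)
Lemma error_coord_estimates : exists (A : 'cV[R]_nz -> 'cV[R]_nz) (a C : R),
  [/\ 0 <= a /\ 0 < C, forall x y, A (x - y) = A x - A y,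
   forall x, `|A x| <= a * `|x|,
   \forall x \near (0 : state R d nz), [/\ state_space Z x,
      `|x.1| <= C * (`|x.2| + `|e x|) & `|e x| <= C * `|x|] &
   forall eps : R, 0 < eps ->
    (exists2 K : R, 0 < K & \forall x \near (0 : state R d nz),
      `|omega x - A x.2| <= K * `|e x| + eps * `|x.2|) /\
    (\forall z \near (0 : 'cV[R]_nz), `|omega (psi z, z) - A z| <= eps * `|z|)].
Proof.
pose Dw (x : state R d nz) : 'cV[R]_nz := 'd omega (0 : state R d nz) x.
pose A z := Dw (Dpsi z, z).
have wD : differentiable omega (0 : state R d nz) by exact: omega_diff.
have [Cp Cp0 HCp] := diff_bound (psi_diff Z0).
have [Cw Cw0 HCw] := diff_bound wD.
have [Ce Ce0 HCe] := diff_bound (error_coord_differentiable S0).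
have [C C0 HC] := eta_near.
pose C' := 2 * (Cp + C) + 1 + (Ce + 1).
have AB x y : A (x - y) = A x - A y.
  rewrite /A /Dw -linearB; congr ('d _ _ _).
  by rewrite /Dpsi linearB.
have Ab x : `|A x| <= Cw * (Cp + 1) * `|x|.
  rewrite (le_trans (HCw _))// -mulrA ler_wpM2l ?(ltW Cw0)//.
  rewrite (le_trans (norm_state _))//= mulrDl mul1r lerD2r; exact: HCp.
have C'0 : 0 < C' by rewrite /C'; lra.
have S_near : \forall x \near (0 : state R d nz), S x.
  by apply: open_nbhs_nbhs; split; [exact: open_state_space|].
have eta_C : \forall x \near (0 : state R d nz), `|x.1| <= C' * (`|x.2| + `|e x|).
  (* With this eps the error term is at most |x| / 2, and its share in [x.1] is absorbed into the
     left-hand side. *)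
  have eps0 : 0 < (2 * C)^-1 by rewrite invr_gt0 mulr_gt0.
  apply: filterS (HC _ eps0) => x; rewrite mulrDr mulrA.
  have -> : C * (2 * C)^-1 = 2^-1 by field; rewrite gt_eqF.
  move=> xe; have := norm_state x; have := HCp x.2.
  have : `|x.1| <= `|x.1 - Dpsi x.2| + `|Dpsi x.2|.
    by rewrite -{1}(subrK (Dpsi x.2) x.1) ler_normD.
  rewrite -/(Dpsi x.2).
  move: (normr_ge0 x.2) (normr_ge0 (e x)) xe; rewrite /C'.
  move: `|x.2| `|e x| `|x.1| `|_ - _| `|Dpsi _| `|x|.
  move=> X2 EX X1 D P X X20 EX0 h1 h2 h3 h4.
  have : X1 <= 2 * (C * EX) + (1 + 2 * Cp) * X2 by lra.
  nra.
have e_C : \forall x \near (0 : state R d nz), `|e x| <= C' * `|x|.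
  apply: filterS (diff_near (error_coord_differentiable S0) ltr01) => x.
  rewrite addr0 e0 subr0 => ex; have := HCe x.
  have : `|e x| <= `|e x - 'd e (0 : state R d nz) x| +
      `|'d e (0 : state R d nz) x|.
    by rewrite -{1}(subrK ('d e (0 : state R d nz) x) (e x)) ler_normD.
  move: (normr_ge0 x) ex; rewrite /C'.
  move: `|e x| `|_ - _| `|'d _ _ _| `|x| => EX D P X X0 h1 h2 h3.
  have : EX <= (Ce + 1) * X by lra.
  nra.
have w_near (eps : R) : 0 < eps ->
    exists2 K : R, 0 < K & \forall x \near (0 : state R d nz),
      `|omega x - A x.2| <= K * `|e x| + eps * `|x.2|.
  (* The linearization errors add up to (1 + Cw C) e1 |x|, and |x| <= (C' + 1)(|x.2| + |e x|);
     taking e1 = eps / B turns this into eps (|x.2| + |e x|). *)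
  move=> eps0; pose B := (1 + Cw * C) * (C' + 1).
  have CwC0 : 0 < Cw * C by rewrite mulr_gt0.
  have B0 : 0 < B by rewrite mulr_gt0; lra.
  have [e1 e10 e1B] : exists2 e1 : R, 0 < e1 & e1 * B = eps.
    by exists (eps / B); rewrite ?divr_gt0 ?divfK// gt_eqF.
  exists (Cw * C + eps); first by rewrite addr_gt0.
  near=> x.
  have w1 : `|omega x - Dw x| <= e1 * `|x|.
    near: x; apply: filterS (diff_near wD e10) => x.
    by rewrite addr0 omega0 subr0.
  have w2 : `|x.1 - Dpsi x.2| <= C * (`|e x| + e1 * `|x|).
    by near: x; exact: HC.
  have w3 : `|x.1| <= C' * (`|x.2| + `|e x|) by near: x.
  (* [A x.2] is [Dw] at the tangent vector over [x.2], so the difference sees only the deviation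
     from it. *)
  have w4 : Dw x - A x.2 = Dw (x.1 - Dpsi x.2, 0).
    rewrite /A /Dw -linearB; congr ('d _ _ _).
    by apply: injective_projections; rewrite /= ?subrr.
  have w5 : `|Dw x - A x.2| <= Cw * `|x.1 - Dpsi x.2|.
    rewrite w4 (le_trans (HCw _))// ler_wpM2l ?(ltW Cw0)//.
    by rewrite (le_trans (norm_state _))//= normr0 addr0.
  have := ler_distD (Dw x) (omega x) (A x.2).
  have := norm_state x.
  have xB : e1 * ((1 + Cw * C) * ((C' + 1) * (`|x.2| + `|e x|))) =
      eps * (`|x.2| + `|e x|).
    by rewrite -e1B /B; ring.
  move: w1 w2 w3 w5 xB (normr_ge0 x.2) (normr_ge0 (e x)) (normr_ge0 x).
  move: `|omega x - A _| `|omega x - _| `|Dw x - _| `|x.1 - _| `|x.2| `|e x| `|x.1| `|x|.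
  move=> W0 W1 W2 D X2 EX X1 X h1 h2 h3 h4 xB X20 EX0 X0 h5 h6.
  have h7 : X <= (C' + 1) * (X2 + EX) by nra.
  have h8 : Cw * D <= Cw * C * (EX + e1 * X) by rewrite -mulrA ler_wpM2l ?(ltW Cw0).
  have h9 : (1 + Cw * C) * (e1 * X) <= eps * (X2 + EX).
    rewrite -xB mulrCA ler_wpM2l ?(ltW e10)// ler_wpM2l//.
    by rewrite addr_ge0// ltW.
  lra.
exists A, (Cw * (Cp + 1)), C'; split => //.
- by split => //; rewrite mulr_ge0 ?addr_ge0// ltW.
- by near=> x; split; near: x.
- move=> eps eps0; split; first exact: w_near.
  have [K _ HK] := w_near eps eps0.
  near=> z.
  have Zz : Z z by near: z; exact: open_nbhs_nbhs.
  (* On the manifold e vanishes, so the second estimate is the first one restricted to the graph of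
     psi. *)
  suff : `|omega (psi z, z) - A z| <= K * `|e (psi z, z)| + eps * `|z|.
    by rewrite e_manifold// normr0 mulr0 add0r.
  near: z.
  have gc : ((psi z, z) : state R d nz) @[z --> (0 : 'cV[R]_nz)] -->
      (0 : state R d nz).
    rewrite -psi0E; apply: (@differentiable_continuous _ _ _ _ (fun z => (psi z, z))).
    by apply: differentiable_pair; [exact: psi_diff|exact: ex_diff].
  exact: gc HK.
Unshelve. all: by end_near. Qed.

End estimates.

(** * Decay along closed-loop solutions *)

Section shift.
Context {R : realType} {E : normedModType R}.

Lemma is_derive_shift_arg (x : R -> E) (s t : R) (dx : E) :
  is_derive (s + t) 1 x dx -> is_derive t 1 (fun r => x (s + r)) dx.
Proof.
have eqx : (fun h : R => h^-1 *: (x (s + (h *: 1 + t)) - x (s + t))) =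
    (fun h : R => h^-1 *: (x (h *: 1 + (s + t)) - x (s + t))).
  by apply/funext => h; rewrite addrCA.
move=> [xd <-]; apply: DeriveDef; last by rewrite /derive /= eqx.
by move: xd; rewrite /derivable /= eqx.
Qed.

Lemma solution_continuous (S : set E) (F : E -> E) (T : R) (x : R -> E) (t : R) :
  is_solution S F T x -> 0 < t < T -> {for t, continuous x}.
Proof.
move=> [_ _ xd] /xd[xt _]; exact/differentiable_continuous/derivable1_diffP.
Qed.

Lemma is_solution_shift (S : set E) (F : E -> E) (T s : R) (x : R -> E) :
  is_solution S F T x -> 0 <= s < T ->
  is_solution S F (T - s) (fun t => x (s + t)).
Proof.
move=> xs /andP[s0 sT]; have [x0 xS xd] := xs; split.
- move: s0; rewrite addr0 le_eqVlt => /predU1P[<-|s0].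
    by under eq_fun do rewrite add0r.
  have xc : {for s, continuous x} by apply: solution_continuous xs _; rewrite s0.
  rewrite -[x s](congr1 x (addr0 s)); apply: cvg_at_right_filter.
  suff : {for 0, continuous (fun t => x (s + t))} by [].
  apply/continuous_atP => e e0; have /continuous_atP/(_ _ e0)[dl dl0 H] := xc.
  exists dl => // t; rewrite sub0r normrN addr0 => tdl; apply: H.
  by rewrite opprD addrA subrr sub0r normrN.
- by move=> t /andP[t0 tT]; apply: xS; rewrite addr_ge0//= addrC -ltrBrDr.
- move=> t /andP[t0 tT]; apply: is_derive_shift_arg; apply: xd.
  by rewrite ltr_wpDl//= addrC -ltrBrDr.
Qed.

Lemma is_solution_le (S : set E) (F : E -> E) (T T' : R) (x : R -> E) :
  T' <= T -> is_solution S F T x -> is_solution S F T' x.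
Proof.
move=> TT [x0 xS xd]; split => // t /andP[t0 tT].
  by apply: xS; rewrite t0 (lt_le_trans tT).
by apply: xd; rewrite t0 (lt_le_trans tT).
Qed.

End shift.

Lemma expR_small {R : realType} (M lam t : R) : 0 < M -> 0 < lam ->
  4 * M / lam <= t -> M * expR (- lam * t) <= 4^-1.
Proof.
move=> M0 lam0; rewrite ler_pdivrMr// => tM.
rewrite mulNr expRN ler_pdivrMr ?expR_gt0//.
have := expR_ge1Dx (lam * t); lra.
Qed.

(** Halving over each complete window gives geometric decay at the times m tau, and K covers the
    remaining fraction of a window. *)
Lemma halving_exp_decay {R : realType} (W : R -> R) (T tau K : R) :
  0 < tau -> 0 <= K -> 0 <= W 0 ->
  (forall s t : R, 0 <= s -> s <= t -> t < T -> t <= s + tau -> W t <= K * W s) ->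
  (forall s : R, 0 <= s -> s + tau < T -> W (s + tau) <= W s / 2) ->
  forall t : R, 0 <= t < T ->
    W t <= 2 * K * expR (- (ln 2 / tau) * t) * W 0.
Proof.
move=> tau0 K0 W0 grow halve t /andP[t0 tT].
have Wm m : m%:R * tau < T -> W (m%:R * tau) <= 2^-1 ^+ m * W 0.
  elim: m => [|m IH] mT; first by rewrite mul0r expr0 mul1r.
  have mE : m.+1%:R * tau = m%:R * tau + tau by rewrite -natr1; ring.
  have m0 : 0 <= m%:R * tau by rewrite mulr_ge0// ltW.
  rewrite mE in mT *; apply: (le_trans (halve _ m0 mT)).
  have /IH : m%:R * tau < T by lra.
  by rewrite exprS; lra.
set m := Num.truncn (t / tau).
have /truncn_itv : 0 <= t / tau by rewrite divr_ge0// ltW.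
rewrite -/m => /andP[]; rewrite ler_pdivlMr// ltr_pdivrMr// => m1 m2.
have m0 : 0 <= m%:R * tau by rewrite mulr_ge0// ltW.
have mtau : t <= m%:R * tau + tau by move: m2; rewrite -natr1; lra.
apply: (le_trans (grow _ _ m0 m1 tT mtau)).
rewrite -!mulrA mulrCA ler_wpM2l// [leRHS]mulrA.
apply: (le_trans (Wm m (le_lt_trans m1 tT))); rewrite ler_wpM2r//.
have ln20 : 0 < ln 2 :> R by rewrite ln_gt0// ltr1n.
(* Rewriting with the exponent m + 1 costs a factor 2 and allows t <= (m + 1) tau to be used. *)
have -> : 2^-1 ^+ m = 2 * expR (- (m.+1%:R * ln 2)) :> R.
  rewrite expRN expRM_natl lnK ?posrE// exprS invfM mulrA divff// mul1r.
  by rewrite exprVn.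
rewrite ler_wpM2l// ler_expR mulNr lerN2 mulrAC ler_pdivrMr//.
by rewrite -[leRHS]mulrA [leRHS]mulrCA ler_wpM2l// ltW.
Qed.

(** Both curves nearly follow A, so their difference satisfies Gronwall's inequality with forcing q
    + eps |z| + eps |w|. Bounding |z| by |z - w| + |w| and using eps <= 1 puts one term into the
    rate a + 1, which makes K independent of eps. *)
Lemma perturbed_flow {R : realType} (n : nat) (A : 'cV[R]_n -> 'cV[R]_n)
    (a tau : R) :
  0 <= a -> 0 <= tau ->
  (forall x y, A (x - y) = A x - A y) -> (forall x, `|A x| <= a * `|x|) ->
  exists2 K : R, 0 < K &
  forall (z dz w dw : R -> 'cV[R]_n) (T q eps B t : R),
    0 <= q -> 0 <= eps <= 1 -> 0 <= B -> z 0 = w 0 ->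
    z s @[s --> 0^'+] --> z 0 -> w s @[s --> 0^'+] --> w 0 ->
    (forall s : R, 0 < s < T -> is_derive s 1 z (dz s)) ->
    (forall s : R, 0 < s < T -> is_derive s 1 w (dw s)) ->
    (forall s : R, 0 < s < T -> `|dz s - A (z s)| <= q + eps * `|z s|) ->
    (forall s : R, 0 < s < T -> `|dw s - A (w s)| <= eps * `|w s|) ->
    (forall s : R, 0 < s < T -> `|w s| <= B) ->
    0 <= t < T -> t <= tau -> `|z t - w t| <= K * (q + 2 * eps * B).
Proof.
move=> a0 tau0 AB Aa.
have [|K K0 HK] := @gronwall R n (a + 1) tau _ tau0; first exact: addr_ge0.
exists K => // z dz w dw T q eps B t q0 /andP[eps0 eps1] B0 zw0 zr wr zd wd.
move=> zA wA wB tT ttau.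
apply: (HK (fun s => z s - w s) (fun s => dz s - dw s) _ T) => //.
- by rewrite addr_ge0// mulr_ge0// mulr_ge0.
- by rewrite zw0 subrr.
- exact: cvgB.
- by move=> s sT; have := zd s sT; have := wd s sT => *; exact: is_deriveB.
- move=> s sT; have := zA s sT; have := wA s sT; have := wB s sT.
  have dE : dz s - dw s = A (z s - w s) + ((dz s - A (z s)) - (dw s - A (w s))).
    by apply/colP => i; rewrite AB !mxE; ring.
  have h1 : `|dz s - dw s| <= `|A (z s - w s)| +
      (`|dz s - A (z s)| + `|dw s - A (w s)|).
    by rewrite {1}dE (le_trans (ler_normD _ _))// lerD2l ler_normB.
  have h2 : `|z s| <= `|z s - w s| + `|w s|.
    by rewrite -{1}(subrK (w s) (z s)) ler_normD.
  have := Aa (z s - w s); move: h1 h2.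
  move: (normr_ge0 (z s - w s)) (normr_ge0 (w s)).
  move: `|dz s - dw s| `|A _| `|dz s - _| `|dw s - _| `|z s| `|_ - _| `|w s|.
  by move=> X1 X2 X3 X4 X5 X6 X7; nra.
Qed.

Section closed_loop.
Context {R : realType} {d nz : nat}.
Variables (Z : set 'cV[R]_nz) (omega : state R d nz -> 'cV[R]_nz).
Variables (y : state R d nz -> R) (V : 'cV[R]_d.+1 -> R) (k1 k2 k3 : R).
Variable k : state R d nz -> R.
Let e := error_coord (drift omega) y d.+1.
Hypothesis e_diff : forall x, state_space Z x -> differentiable e x.
Hypothesis hV : is_output_CLF Z omega y V k1 k2 k3.
Hypothesis hk : output_stabilizing Z omega y V k3 k.

(** V along the solution decays at rate k3; passing to e through the quadratic bounds takes a square
    root, hence the constant sqrt(k2 / k1) and the rate k3 / 2. *)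
Lemma error_exp_decay : exists2 c : R, 0 < c & forall (T : R) x,
  0 < T -> is_solution (state_space Z) (closed_loop omega k) T x ->
  forall t : R, 0 <= t < T ->
    `|e (x t)| <= c * expR (- (k3 / 2) * t) * `|e (x 0)|.
Proof.
have [[k10 k20 k30] Vd Vk _] := hV.
have Ved x : state_space Z x -> differentiable (V \o e) x.
  by move=> Sx; apply: differentiable_comp; [exact: e_diff|exact: Vd].
exists (Num.sqrt (k2 / k1)); first by rewrite sqrtr_gt0 divr_gt0.
move=> T x T0 xs t tT; have [x0 xS xd] := xs.
pose N s := (V \o e) (x s).
have N0 : N s @[s --> 0^'+] --> N 0.
  have x0S : state_space Z (x 0) by apply: xS; rewrite lexx.
  have Vec := differentiable_continuous (Ved _ x0S).
  by move=> B NB; exact: (x0 _ (Vec _ NB)).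
have Nd s : 0 < s < T ->
    is_derive s 1 N ('d (V \o e) (x s) (closed_loop omega k (x s))).
  move=> sT; apply: is_derive_diff_comp; first exact: xd.
  by apply/Ved/xS; move: sT => /andP[/ltW -> ->].
have Nle s : 0 < s < T ->
    'd (V \o e) (x s) (closed_loop omega k (x s)) <= - k3 * N s + 0.
  (* At the point [x s], the field with input frozen at [k (x s)] is the closed-loop field, so
     [Vdot] is this derivative. *)
  move=> /andP[s0 sT]; rewrite addr0; apply: hk; apply: xS.
  by rewrite ltW.
have k3n : - k3 != 0 by rewrite oppr_eq0 gt_eqF.
have := gronwall_scalar k3n N0 Nd Nle tT.
rewrite mul0r !addr0 => Nt.
have /andP[V1 _] := Vk (e (x t)); have /andP[_ V2] := Vk (e (x 0)).
rewrite -(@ler_pXn2r _ 2)// ?nnegrE ?mulr_ge0 ?expR_ge0 ?sqrtr_ge0//.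
rewrite !exprMn sqr_sqrtr ?divr_ge0 ?(ltW k10) ?(ltW k20)//.
rewrite -expRM_natl (_ : 2%:R * (- (k3 / 2) * t) = - k3 * t); last by field.
rewrite -(ler_pM2l k10) (le_trans V1)// (le_trans Nt)//.
have -> : k1 * (k2 / k1 * expR (- k3 * t) * `|e (x 0)| ^+ 2) =
    k2 * `|e (x 0)| ^+ 2 * expR (- k3 * t) by field; rewrite gt_eqF.
by rewrite ler_wpM2r// expR_ge0.
Qed.

End closed_loop.

Lemma near0_ball {R : realType} {E : normedModType R} (P : E -> Prop) :
  (\forall x \near (0 : E), P x) ->
  exists2 r : R, 0 < r & forall x, `|x| < r -> P x.
Proof.
move=> /nbhs_ballP[r /= r0 H]; exists r => // x xr; apply: H.
by rewrite -ball_normE/= sub0r normrN.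
Qed.

Lemma is_derive_snd {R : realType} {E W : normedModType R} (x : R -> E * W)
    (t : R) (dx : E * W) :
  is_derive t 1 x dx -> is_derive t 1 (fun s => (x s).2) dx.2.
Proof.
move=> xt; have sc : continuous (snd : E * W -> W) by move=> p; exact: cvg_snd.
have sD : differentiable (snd : E * W -> W) (x t) by exact: linear_differentiable.
by have := is_derive_diff_comp xt sD; rewrite diff_lin.
Qed.

(** * Local exponential stability of the full state *)

Theorem theorem1 (R : realType) (d nz : nat) (Z : set 'cV[R]_nz)
    (omega : state R d nz -> 'cV[R]_nz) (psi : 'cV[R]_nz -> 'cV[R]_d.+1)
    (V : 'cV[R]_d.+1 -> R) (k1 k2 k3 : R) (k : state R d nz -> R)
    (hZ : open Z)
    (homega : C1_on (state_space Z) omega)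
    (homega12 : omega_eta12_only Z omega)
    (hpsi : forall z, Z z -> differentiable psi z)
    (hpsi0 : psi 0 = 0)
    (hreldeg : has_relative_degree (state_space Z) (drift omega)
       (@input_field R d nz) (output psi) d.+1)
    (hmanifold : zeroing_manifold Z omega (output psi) = manifold_of Z psi)
    (hzero : exp_stable Z (zero_dynamics omega psi))
    (hV : is_output_CLF Z omega (output psi) V k1 k2 k3)
    (hk : output_stabilizing Z omega (output psi) V k3 k) :
  exp_stable (state_space Z) (closed_loop omega k).
Proof.
have [D0 [oD D00 DZ stab]] := hzero.
have Z0 : Z 0 := DZ 0 D00.
have omega_diff x : state_space Z x -> differentiable omega x.
  by case: homega => H _; exact: H.
have f0_cont z : D0 z -> {for z, continuous (zero_dynamics omega psi)}.
  move=> /DZ Zz; apply: differentiable_continuous.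
  pose g z : state R d nz := (psi z, z).
  apply: (@differentiable_comp _ _ _ _ g omega); last exact: omega_diff.
  by apply: differentiable_pair; [exact: hpsi|exact: ex_diff].
have [M [lam [rho [M1 lam0 rho0 flow]]]] := exp_stable_flow oD D00 DZ f0_cont stab.
have omega0 : omega 0 = 0.
  by have := exp_stable_flow_equilibrium rho0 flow; rewrite /zero_dynamics hpsi0.
have [A [a [C [[a0 C0] AB Aa est1 est2]]]] := error_coord_estimates hZ Z0
  omega_diff homega12 hreldeg hpsi hpsi0 hmanifold omega0.
have e_diff := error_coord_differentiable hreldeg.
have [[k10 k20 k30] _ _ _] := hV.
have [c c0 decay] := error_exp_decay e_diff hV hk.
set e := error_coord (drift omega) (output psi) d.+1 in est1 est2 decay.
have M0 : 0 < M by exact: lt_le_trans M1.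
have k320 : 0 < k3 / 2 by rewrite divr_gt0.
(* The two summands make the decay factors of the zero dynamics and of e at most 1/4 each. *)
pose tau := 4 * M / lam + 4 * c / (k3 / 2).
have t1 : 0 < 4 * M / lam by rewrite divr_gt0 ?mulr_gt0.
have t2 : 0 < 4 * c / (k3 / 2) by rewrite divr_gt0 ?mulr_gt0.
have tau0 : 0 < tau by rewrite addr_gt0.
have Mtau : M * expR (- lam * tau) <= 4^-1.
  by apply: expR_small; rewrite // lerDl ltW.
have ctau : c * expR (- (k3 / 2) * tau) <= 4^-1.
  by apply: expR_small; rewrite // lerDr ltW.
have [K K0 pert] := perturbed_flow a0 (ltW tau0) AB Aa.
have MK0 : 0 < M * K by rewrite mulr_gt0.
(* Chosen after K, so that the comparison error [K * (2 * eps * M)] is at most 1/4. *)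
pose eps : R := (8 * (M * K) + 1)^-1.
have eps0 : 0 < eps by rewrite invr_gt0; lra.
have eps1 : eps <= 1 by rewrite invf_le1; lra.
have epsMK : K * (2 * eps * M) <= 4^-1.
  have : eps * (8 * (M * K) + 1) = 1 by rewrite mulVf// gt_eqF//; lra.
  by lra.
have [[C2 C20 w_near] f0_near] := est2 eps eps0.
have [r1 r10 H1] := near0_ball (filterI est1 w_near).
have [r2 r20 H2] := near0_ball f0_near.
(* Inside this radius the estimates at the origin hold, and a zero-dynamics solution started at
   [x.2] exists and stays within r2. *)
pose rs := Num.min r1 (Num.min rho r2 / M).
have rs0 : 0 < rs by rewrite lt_min r10 divr_gt0// lt_min rho0.
have rs1 x : x < rs -> x < r1 by rewrite lt_min => /andP[].
have rsM x : x < rs -> M * x < rho /\ M * x < r2.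
  by rewrite lt_min ltr_pdivlMr// lt_min mulrC => /andP[_ /andP[]].
have expRle1 (l t : R) : 0 < l -> 0 <= t -> expR (- l * t) <= 1.
  by move=> l0 t0; rewrite -expR0 ler_expR mulNr oppr_le0 mulr_ge0// ltW.
pose K' := K * (C2 * c).
have K'0 : 0 < K' by rewrite !mulr_gt0.
(* One window: [x.2] is compared with the zero-dynamics solution w from the same initial point, with
   e entering as forcing of size C2 c |e (x 0)|. *)
have window x T t : is_solution (state_space Z) (closed_loop omega k) T x ->
    (forall s : R, 0 <= s < T -> `|x s| < rs) -> 0 <= t < T -> t <= tau ->
    `|(x t).2| <= (M * expR (- lam * t) + 4^-1) * `|(x 0).2| + K' * `|e (x 0)|.
  move=> xsol xrs tT ttau.
  have T0 : 0 < T by case/andP: tT; exact: le_lt_trans.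
  have [xr xS xd] := xsol.
  have norm2 p : `|(p : state R d nz).2| <= `|p|.
    by rewrite prod_normE le_max lexx orbT.
  have x0rs : `|(x 0).2| < rs.
    by apply: le_lt_trans (norm2 _) _; apply: xrs; rewrite lexx.
  have [x0rho x0r2] := rsM _ x0rs.
  have [w [w0 wr wd wle]] := flow _ x0rho.
  have wB s : 0 <= s -> `|w s| <= M * `|(x 0).2|.
    move=> s0; apply: (le_trans (wle s s0)); rewrite ler_wpM2r//.
    by rewrite ler_piMr ?(ltW M0)// expRle1.
  have := pert (fun s => (x s).2) (fun s => omega (x s)) w
    (fun s => zero_dynamics omega psi (w s)) T (C2 * (c * `|e (x 0)|)) eps
    (M * `|(x 0).2|) t.
  have -> : K * (C2 * (c * `|e (x 0)|) + 2 * eps * (M * `|(x 0).2|)) =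
      K' * `|e (x 0)| + K * (2 * eps * M) * `|(x 0).2| by rewrite /K'; ring.
  move=> H; have {H} : `|(x t).2 - w t| <=
      K' * `|e (x 0)| + K * (2 * eps * M) * `|(x 0).2|.
    apply: H => //.
    - by rewrite !mulr_ge0 ?(ltW C20) ?(ltW c0).
    - by rewrite eps1 ltW.
    - by rewrite mulr_ge0// ltW.
    - move=> B xB; apply: (xr (fun p => B p.2)); exact: (cvg_snd xB).
    - move=> s sT; have := is_derive_snd (xd s sT).
      by rewrite /closed_loop/= scaler0 addr0.
    - by move=> s /andP[s0 _]; exact: wd.
    - move=> s /andP[s0 sT]; have sT' : 0 <= s < T by rewrite ltW.
      have [_ Hw] := H1 _ (rs1 _ (xrs s sT')).
      apply: (le_trans Hw); rewrite lerD2r ler_wpM2l ?(ltW C20)//.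
      apply: (le_trans (decay T x T0 xsol s sT')); rewrite ler_wpM2r//.
      by rewrite ler_piMr ?(ltW c0)// expRle1// ltW.
    - move=> s /andP[s0 _]; apply: H2; apply: le_lt_trans x0r2.
      by apply: wB; exact: ltW.
    - by move=> s /andP[s0 _]; apply: wB; exact: ltW.
  have := wle t; case/andP: (tT) => t0 _ /(_ t0).
  have : `|(x t).2| <= `|(x t).2 - w t| + `|w t|.
    by rewrite -{1}(subrK (w t) (x t).2) ler_normD.
  have : K * (2 * eps * M) * `|(x 0).2| <= 4^-1 * `|(x 0).2| by rewrite ler_wpM2r.
  by lra.
(* The coupling K' |e| must fit into kap / 4 for the weighted sum W to be halved; the added 1 also
   gives kap >= 1, hence |e| <= kap |e|. *)
pose kap := 4 * K' + 1.
have kap0 : 0 < kap by rewrite /kap; lra.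
pose W (p : state R d nz) : R := `|p.2| + kap * `|e p|.
have W0 p : 0 <= W p by rewrite addr_ge0// mulr_ge0// ltW.
pose KW := M + 1 + 1 + c.
have KW0 : 0 < KW by rewrite /KW; lra.
have Wdecay x T : is_solution (state_space Z) (closed_loop omega k) T x ->
    (forall s : R, 0 <= s < T -> `|x s| < rs) -> forall t : R, 0 <= t < T ->
    W (x t) <= 2 * KW * expR (- (ln 2 / tau) * t) * W (x 0).
  move=> xsol xrs.
  (* The closed loop is autonomous, so the window estimate and the decay of e may be restarted at
     any time s. *)
  have shifted s t : 0 <= s -> s <= t -> t < T -> t <= s + tau ->
      `|(x t).2| <= (M * expR (- lam * (t - s)) + 4^-1) * `|(x s).2| +
        K' * `|e (x s)|
      /\ `|e (x t)| <= c * expR (- (k3 / 2) * (t - s)) * `|e (x s)|.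
    move=> s0 st tT tst.
    have sT : 0 <= s < T by rewrite s0 (le_lt_trans st).
    have sol := is_solution_shift xsol sT.
    have ts : 0 <= t - s < T - s by rewrite subr_ge0 st ltrD2r.
    split.
      have := window _ _ (t - s) sol; rewrite addr0 (addrC s) subrK; apply => //.
        move=> r /andP[r0 rT]; apply: xrs; rewrite addr_ge0//=.
        by rewrite addrC -ltrBrDr.
      by rewrite lerBlDl.
    have Ts0 : 0 < T - s by rewrite subr_gt0; case/andP: sT.
    have := decay _ _ Ts0 sol (t - s) ts.
    by rewrite addr0 (addrC s) subrK.
  apply: (@halving_exp_decay _ (fun t => W (x t))) => //.
  - exact: ltW.
  - move=> s t s0 st tT tst; have [h1 h2] := shifted s t s0 st tT tst.
    have ts0 : 0 <= t - s by rewrite subr_ge0.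
    have e1 := expRle1 _ _ lam0 ts0; have e2 := expRle1 _ _ k320 ts0.
    have h3 : `|(x t).2| <= (M + 1) * `|(x s).2| + K' * `|e (x s)|.
      apply: (le_trans h1); rewrite lerD2r ler_wpM2r// lerD//; last by lra.
      by rewrite ler_piMr// ltW.
    have h4 : `|e (x t)| <= c * `|e (x s)|.
      by apply: (le_trans h2); rewrite ler_wpM2r// ler_piMr// ltW.
    have h5 : kap * `|e (x t)| <= kap * (c * `|e (x s)|).
      by rewrite ler_wpM2l// ltW.
    have h6 : 0 <= kap * `|e (x s)| by rewrite mulr_ge0// ltW.
    have h7 : K' * `|e (x s)| <= kap * `|e (x s)|.
      by rewrite ler_wpM2r// /kap; clear -K'0; lra.
    have h8 := normr_ge0 (x s).2; have := normr_ge0 (e (x s)).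
    rewrite /W /KW.
    have : (M + 1 + 1 + c) * (`|(x s).2| + kap * `|e (x s)|) =
       (M + 1) * `|(x s).2| + (1 + c) * `|(x s).2| +
       (M + 1 + 1) * (kap * `|e (x s)|) + kap * (c * `|e (x s)|) by ring.
    have : 0 <= (1 + c) * `|(x s).2| by rewrite mulr_ge0//; clear -c0; lra.
    have : kap * `|e (x s)| <= (M + 1 + 1) * (kap * `|e (x s)|).
      by rewrite ler_peMl//; clear -M0; lra.
    by clear -h3 h5 h7; lra.
  - move=> s s0 sT.
    have sts : s <= s + tau by rewrite lerDl ltW.
    have [h1 h2] := shifted s (s + tau) s0 sts sT (lexx _).
    rewrite [s + tau - s]addrAC subrr add0r in h1 h2.
    have h3 : `|(x (s + tau)).2| <= 2^-1 * `|(x s).2| + K' * `|e (x s)|.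
      by apply: (le_trans h1); rewrite lerD2r ler_wpM2r//; clear -Mtau; lra.
    have h4 : kap * `|e (x (s + tau))| <= kap * (4^-1 * `|e (x s)|).
      by rewrite ler_wpM2l ?(ltW kap0)// (le_trans h2)// ler_wpM2r.
    have := normr_ge0 (e (x s)).
    by move: h3 h4; rewrite /W /kap; clear; lra.
(* The factors come from |x| <= (C + 1) W x, from the decay of W, and from W x <= (1 + kap C)
   |x|. *)
pose Mf := (C + 1) * (2 * KW * (1 + kap * C)).
have kapC0 : 0 < kap * C by rewrite mulr_gt0.
have Mf1 : 1 <= Mf.
  have h : 1 <= 2 * KW * (1 + kap * C).
    rewrite -[leLHS]mulr1 ler_pM//; last by clear -kapC0; lra.
    by rewrite /KW; clear -M1 c0; lra.
  by rewrite -[leLHS]mulr1 ler_pM//; clear -C0; lra.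
have Mf0 : 0 < Mf by exact: lt_le_trans Mf1.
pose mu := ln 2 / tau.
have mu0 : 0 < mu by rewrite divr_gt0// ln_gt0// ltr1n.
have bound x T : is_solution (state_space Z) (closed_loop omega k) T x ->
    (forall s : R, 0 <= s < T -> `|x s| < rs) -> forall t : R, 0 <= t < T ->
    `|x t| <= Mf * expR (- mu * t) * `|x 0|.
  move=> xsol xrs t tT; have := Wdecay x T xsol xrs t tT; rewrite -/mu => Wt.
  have T0 : 0 < T by case/andP: tT; exact: le_lt_trans.
  have [[_ h1 _] _] := H1 _ (rs1 _ (xrs t tT)).
  have x0rs : `|x 0| < rs by apply: xrs; rewrite lexx.
  have [[_ _ h2] _] := H1 _ (rs1 _ x0rs).
  have h3 : `|x t| <= (C + 1) * W (x t).
    have h4 : `|e (x t)| <= kap * `|e (x t)|.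
      by rewrite ler_peMl// /kap; clear -K'0; lra.
    apply: (@le_trans _ _ (`|(x t).1| + `|(x t).2|)).
      by rewrite prod_normE ge_max lerDl lerDr !normr_ge0.
    rewrite mulrDl mul1r lerD//; last by rewrite lerDl mulr_ge0// ltW.
    by rewrite (le_trans h1)// ler_wpM2l ?(ltW C0)// lerD2l.
  have h5 : W (x 0) <= (1 + kap * C) * `|x 0|.
    have : `|(x 0).2| <= `|x 0| by rewrite prod_normE le_max lexx orbT.
    have : kap * `|e (x 0)| <= kap * (C * `|x 0|) by rewrite ler_wpM2l ?(ltW kap0).
    by rewrite /W; clear; lra.
  apply: (le_trans h3).
  have -> : Mf * expR (- mu * t) * `|x 0| =
     (C + 1) * (2 * KW * expR (- mu * t) * ((1 + kap * C) * `|x 0|)).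
    by rewrite /Mf; ring.
  rewrite ler_wpM2l ?addr_ge0 ?(ltW C0)//; apply: (le_trans Wt).
  by rewrite ler_wpM2l// mulr_ge0 ?expR_ge0// mulr_ge0// ltW.
(* Dividing by Mf leaves room for the overshoot: Mf |x 0| < rs. *)
exists (ball (0 : state R d nz) (rs / Mf)); split.
- exact: ball_open.
- by apply: ballxx; rewrite divr_gt0.
- move=> x; rewrite -ball_normE/= sub0r normrN ltr_pdivlMr// => xrs.
  have [|[Sx _ _] _] // := H1 x.
  apply: rs1; apply: le_lt_trans xrs; exact: ler_peMr.
- exists Mf, mu; split => // T x T0 xsol.
  rewrite -ball_normE/= sub0r normrN ltr_pdivlMr// => x0.
  have [xr xS xd] := xsol.
  (* [bound] presupposes that the solution stays within rs; [bootstrap] with rho' = Mf |x 0|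
     discharges this. *)
  suff xrs : forall t : R, 0 <= t < T -> `|x t| < rs by exact: bound.
  apply: (@bootstrap _ _ x T rs (Mf * `|x 0|)).
  + by rewrite mulrC.
  + exact: xr.
  + by move=> s sT; exact: solution_continuous xsol sT.
  + by apply: le_lt_trans x0; exact: ler_peMr.
  + move=> t /andP[t0 tT] xt s st.
    have solt := is_solution_le (ltW tT) xsol.
    apply: (le_trans (bound x t solt xt s st)); rewrite ler_wpM2r//.
    by rewrite ler_piMr ?(ltW Mf0)// expRle1//; case/andP: st.
Qed.
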